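(* Let $W\subset\mathbb{C}$ be a lattice with generators $w_1,w_2$, let $k\geq 1$ be an integer, and let $a\in\mathbb{C}\setminus W$. Let $(x_0,y_0)\in\mathbb{R}^2$ be the point such that $x_0w_1+y_0w_2=-a$. Then for arbitrarily small $\epsilon>0$ (i.e. for all sufficiently small $\epsilon>0$), $$E_k(a,W)=\sum_{(n,m)\in\mathbb{Z}^2}\frac{1}{(a+nw_1+mw_2)^k}=J_1+J_2+J_3,$$ where $$\begin{aligned}J_1=\int_{-\infty}^{\infty}\biggl[&\frac{1}{(a+xw_1+(y_0+\epsilon)w_2)^k}P_1(y_0+\epsilon)-\frac{1}{(a+xw_1+(y_0-\epsilon)w_2)^k}P_1(y_0-\epsilon)\\&+k\frac{w_1}{(a+xw_1+(y_0-\epsilon)w_2)^{k+1}}P_1(x)P_1(y_0-\epsilon)\\&-k\frac{w_1}{(a+xw_1+(y_0+\epsilon)w_2)^{k+1}}P_1(x)P_1(y_0+\epsilon)\biggr]dx,\end{aligned}$$ $$\begin{aligned}J_2=\iint_{[-\infty,\infty]\times[y_0+\epsilon,\infty]}\biggl[&\frac{1}{(a+xw_1+yw_2)^k}-k\frac{w_1}{(a+xw_1+yw_2)^{k+1}}P_1(x)\\&-k\frac{w_2}{(a+xw_1+yw_2)^{k+1}}P_1(y)+k(k+1)\frac{w_1w_2}{(a+xw_1+yw_2)^{k+2}}P_1(x)P_1(y)\biggr]dx\,dy,\end{aligned}$$ $$\begin{aligned}J_3=\iint_{[-\infty,\infty]\times[-\infty,y_0-\epsilon]}\biggl[&\fr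ac{1}{(a+xw_1+yw_2)^k}-k\frac{w_1}{(a+xw_1+yw_2)^{k+1}}P_1(x)\\&-k\frac{w_2}{(a+xw_1+yw_2)^{k+1}}P_1(y)+k(k+1)\frac{w_1w_2}{(a+xw_1+yw_2)^{k+2}}P_1(x)P_1(y)\biggr]dx\,dy.\end{aligned}$$
   Context: For real $x$, $[x]$ denotes the integer part (floor) of $x$, and $P_1(x)=B_1(x-[x])=x-[x]-\tfrac12$ is the first periodized Bernoulli polynomial. A lattice $W$ in $\mathbb{C}$ with generators $w_1,w_2$ is the set of points $nw_1+mw_2$ with $n,m\in\mathbb{Z}$, where $w_1,w_2$ are linearly independent over $\mathbb{R}$. Weil's elliptic function is $$E_k(a,W)=\sum_{w\in W}\frac{1}{(a+w)^k}=\sum_{(n,m)\in\mathbb{Z}^2}\frac{1}{(a+nw_1+mw_2)^k},\qquad a\notin W.$$ For $k\geq 3$ the series is absolutely convergent. For $k=1$ and $k=2$ the sum is understood as the Eisenstein summation $$\sum_{(n,m)\in\mathbb{Z}^2}\frac{1}{(a+nw_1+mw_2)^k}=\lim_{M\to\infty}\sum_{m=-M}^{M}\left(\lim_{N\to\infty}\sum_{n=-N}^{N}\frac{1}{(a+nw_1+mw_2)^k}\right),$$ and in those two cases the integral $\int_{-\infty}^{\infty}$ is understood as $\lim_{N\to\infty}\int_{-N}^{N}$.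
   Formalization: Added: y_0 is not an integer (for y_0 in Z the right side misses the row m=y_0, so the claim fails, e.g. k=4, w_1=1, w_2=i, a=1/2). For k=1, J_2 and J_3 diverge separately, so J_2+J_3 is read as one limit: x integrated first, then y over [-M,M] minus the gap, M to infinity. *)

(* Defs.v *)
From HB Require Import structures.
From mathcomp Require Import all_boot all_order all_algebra.
From mathcomp Require Import all_classical all_reals all_analysis.
From mathcomp Require Import complex.
From mathcomp Require showcase.summability.

Set Implicit Arguments.
Unset Strict Implicit.
Unset Printing Implicit Defensive.

Import Order.TTheory GRing.Theory Num.Theory.
Import numFieldNormedType.Exports.

Local Open Scope classical_set_scope.
Local Open Scope ring_scope.
Local Open Scope complex_scope.

Section Lattice.
Context {R : realType}.

Definition lattice_generators (w1 w2 : R[i]) : Prop :=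
  forall x y : R, x%:C * w1 + y%:C * w2 = 0 -> x = 0 /\ y = 0.

Definition lattice (w1 w2 : R[i]) : set R[i] :=
  [set z | exists n m : int, z = n%:~R * w1 + m%:~R * w2].

Definition P1 (x : R) : R := x - (Num.floor x)%:~R - 2^-1.

End Lattice.

(* The topology on R[i] is that of the regular algebra R[i]^o, given by the
   complex modulus. *)
Section Summation.
Context {R : realType}.
Implicit Types (u : int -> R[i]^o) (v : int -> int -> R[i]^o).

(* The sum of u j over -N <= j <= N. *)
Definition symmetric_psum u (N : nat) : R[i]^o :=
  \sum_(i < (2 * N).+1) u (i%:Z - N%:Z).

Definition symmetric_sum u : R[i]^o := limn (symmetric_psum u).
Definition symmetric_summable u : Prop := cvgn (symmetric_psum u).

(* v n m: the inner sum is over n, the outer one over m. *)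
Definition eisenstein_sum v : R[i]^o :=
  symmetric_sum (fun m => symmetric_sum (v ^~ m)).

Definition eisenstein_summable v : Prop :=
  (forall m, symmetric_summable (v ^~ m)) /\
  symmetric_summable (fun m => symmetric_sum (v ^~ m)).

(* The sum over Z^2 is the limit along the net of finite subsets. *)
Definition unordered_sum v : R[i]^o :=
  summability.sum (fun p : int * int => v p.1 p.2).

Definition absolutely_summable v : Prop :=
  summable [set: int * int] (fun p => (Normc.normc (v p.1 p.2))%:E).

End Summation.

Section Integration.
Context {R : realType}.

Definition Cintegrable (d : measure_display) (T : measurableType d)
    (mu : {measure set T -> \bar R}) (D : set T) (f : T -> R[i]) : Prop :=
  mu.-integrable D (fun t => (complex.Re (f t))%:E) /\
  mu.-integrable D (fun t => (complex.Im (f t))%:E).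

Definition Cintegral (d : measure_display) (T : measurableType d)
    (mu : {measure set T -> \bar R}) (D : set T) (f : T -> R[i]) : R[i]^o :=
  (\int[mu]_(t in D) complex.Re (f t)) +i*
  (\int[mu]_(t in D) complex.Im (f t)).

Definition integral1 (D : set R) (f : R -> R[i]) : R[i]^o :=
  Cintegral lebesgue_measure D f.
Definition integrable1 (D : set R) (f : R -> R[i]) : Prop :=
  Cintegrable lebesgue_measure D f.

Definition integral2 (D : set (R * R)) (f : R -> R -> R[i]) : R[i]^o :=
  Cintegral (lebesgue_measure \x lebesgue_measure)%E D (fun p => f p.1 p.2).
Definition integrable2 (D : set (R * R)) (f : R -> R -> R[i]) : Prop :=
  Cintegrable (lebesgue_measure \x lebesgue_measure)%E D (fun p => f p.1 p.2).

Definition pv_integral (f : R -> R[i]) : R[i]^o :=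
  lim (integral1 `[- N, N] f @[N --> +oo]).
Definition pv_integrable (f : R -> R[i]) : Prop :=
  (forall N : R, integrable1 `[- N, N] f) /\
  cvg (integral1 `[- N, N] f @[N --> +oo]).

(* Integral over the whole line in a formula of weight k: a symmetric limit
   for k <= 2, a Lebesgue integral for k >= 3. *)
Definition line_integral (k : nat) (f : R -> R[i]) : R[i]^o :=
  if (k <= 2)%N then pv_integral f else integral1 setT f.
Definition line_integrable (k : nat) (f : R -> R[i]) : Prop :=
  if (k <= 2)%N then pv_integrable f else integrable1 setT f.

(* The double integral of f over R x I, cut off to a bounded set I of values
   of y. As in Eisenstein summation, x is integrated first, over the line. *)
Definition strip_integral (k : nat) (I : set R) (f : R -> R -> R[i]) : R[i]^o :=
  integral1 I (fun y => line_integral k (f ^~ y)).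
Definition strip_integrable (k : nat) (I : set R) (f : R -> R -> R[i]) : Prop :=
  (forall y, I y -> line_integrable k (f ^~ y)) /\
  integrable1 I (fun y => line_integral k (f ^~ y)).

End Integration.

Section Weil.
Context {R : realType}.
Variables (w1 w2 : R[i]) (k : nat) (a : R[i]).

Definition inv_pow (j : nat) (x y : R) : R[i] :=
  ((a + x%:C * w1 + y%:C * w2) ^+ j)^-1.

Definition weil_term (n m : int) : R[i]^o := inv_pow k n%:~R m%:~R.

Definition weilE : R[i]^o :=
  if (k <= 2)%N then eisenstein_sum weil_term else unordered_sum weil_term.
Definition weilE_converges : Prop :=
  if (k <= 2)%N then eisenstein_summable weil_term
  else absolutely_summable weil_term.

Variables (y0 eps : R).

Definition J1_integrand (x : R) : R[i] :=
  inv_pow k x (y0 + eps) * (P1 (y0 + eps))%:C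
  - inv_pow k x (y0 - eps) * (P1 (y0 - eps))%:C
  + k%:R * (w1 * inv_pow k.+1 x (y0 - eps)) * (P1 x)%:C * (P1 (y0 - eps))%:C
  - k%:R * (w1 * inv_pow k.+1 x (y0 + eps)) * (P1 x)%:C * (P1 (y0 + eps))%:C.

Definition J1 : R[i]^o := line_integral k J1_integrand.
Definition J1_converges : Prop := line_integrable k J1_integrand.

Definition J23_integrand (x y : R) : R[i] :=
  inv_pow k x y
  - k%:R * (w1 * inv_pow k.+1 x y) * (P1 x)%:C
  - k%:R * (w2 * inv_pow k.+1 x y) * (P1 y)%:C
  + (k * k.+1)%:R * (w1 * w2 * inv_pow k.+2 x y) * (P1 x)%:C * (P1 y)%:C.

Definition J2_upto (M : R) : R[i]^o :=
  strip_integral k `[y0 + eps, M] J23_integrand.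
Definition J3_upto (M : R) : R[i]^o :=
  strip_integral k `[- M, y0 - eps] J23_integrand.

Definition J2 : R[i]^o :=
  if (k <= 2)%N then lim (J2_upto M @[M --> +oo])
  else integral2 (setT `*` `[y0 + eps, +oo[) J23_integrand.
Definition J3 : R[i]^o :=
  if (k <= 2)%N then lim (J3_upto M @[M --> +oo])
  else integral2 (setT `*` `]-oo, y0 - eps]) J23_integrand.

Definition J2_strips_converge : Prop :=
  forall M : R, strip_integrable k `[y0 + eps, M] J23_integrand.
Definition J3_strips_converge : Prop :=
  forall M : R, strip_integrable k `[- M, y0 - eps] J23_integrand.

Definition J2_converges : Prop :=
  if (k <= 2)%N then J2_strips_converge /\ cvg (J2_upto M @[M --> +oo])
  else integrable2 (setT `*` `[y0 + eps, +oo[) J23_integrand.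
Definition J3_converges : Prop :=
  if (k <= 2)%N then J3_strips_converge /\ cvg (J3_upto M @[M --> +oo])
  else integrable2 (setT `*` `]-oo, y0 - eps]) J23_integrand.

(* For k = 1 the inner integral tends to nonzero opposite constants as y tends
   to +oo and -oo, so J2 and J3 diverge separately. J23_pv is their sum, as the
   integral over y in the line minus ]y0 - eps, y0 + eps[, taken as the
   symmetric limit over [-M, M]. *)
Definition J23_pv : R[i]^o :=
  lim (J2_upto M + J3_upto M @[M --> +oo]).
Definition J23_pv_converges : Prop :=
  [/\ J2_strips_converge, J3_strips_converge &
      cvg (J2_upto M + J3_upto M @[M --> +oo])].

End Weil.

(* Pitfall: when y0 is an integer, the lattice points of the row m = y0 lie in
   neither of the domains of J2 and J3, whatever eps > 0, and J1 + J2 + J3 is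
   weilE minus the sum of that row. *)

(* Main.v *)
Require Import Defs.
From HB Require Import structures.
From mathcomp Require Import all_boot all_order all_algebra.
From mathcomp Require Import finmap.
From mathcomp Require Import all_classical all_reals all_analysis.
From mathcomp Require Import complex measurable_realfun.
From mathcomp Require showcase.summability.
From mathcomp Require Import ring lra zify.

(** Write f(x, y) = 1 / (a + x w1 + y w2)^k. On a cell between consecutive
    integers the derivative of P1(x) g(x) is g(x) + P1(x) g'(x), and at an
    integer P1 jumps by -1; hence the integral of g + P1 g' over [b, c] is
    the sum of g over the integers in ]b, c] plus P1(c) g(c) - P1(b) g(b)
    (first-order Euler-Maclaurin summation, [em_derive]). The theorem is this
    identity used twice.

    Along a row, it turns the integral over x of f + P1 f_x into the symmetric
    sum G(y) of f(n, y) over n ([row_line_integral]). Across rows, it is first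
    applied in y to the finite sums over |n| <= N and then carried to the limit
    N -> oo by dominated convergence ([em_rowsum]): away from the row y = y0 of
    the pole, G is summed by integrating G + P1 H, where H is the row sum of
    f_y. The integrand of J2 and J3 integrated over x is exactly G + P1 H.
    So, with E(y) the sum of G over the integers in ]0, y] (counted negatively
    over ]y, 0] when y < 0) plus P1(y) G(y),
      J1 = E(y0 + eps) - E(y0 - eps),
      J2 up to M = E(M) - E(y0 + eps),
      J3 up to M = E(y0 - eps) - E(-M),
    the first because no integer lies between y0 - eps and y0 + eps. The total
    is E(M) - E(-M), which is the sum of G over |m| <= M up to
    P1(M) (G(M) + G(-M)), whether or not M is an integer ([em_prim_sub_opp]).

    What remains is that G(y) + G(-y) is O(|y|^(-3/2)) ([rowsum_pair_decay]),
    and so is G(y) itself when k >= 2 ([rowsum_decay]). For k >= 3 this is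
    termwise. For k = 2 the terms are compared with the telescoping products
    f1(n) f1(n + 1), where f1 is f for k = 1. For k = 1, adding the terms at
    (n, y) and (-n, -y) gives -2a times the terms of weight 2, up to terms of
    weight 3. One majorant, rho(s) = (1 + |s|)^(-3/2), serves for every
    sum and integral: it is summable and integrable, terms of weight 2 are
    O(rho(x)), and terms of weight at least 3 are O(rho(x) rho(y)). The last
    bound also makes the double series and the double integrals absolutely
    convergent when k >= 3, so that both may be computed iteratively
    ([fsum_iterated], [fubini_strip]).

    All analysis is done on the real functions Re (u f) for an arbitrary complex
    u; the values u = 1 and u = -i give back the real and imaginary parts. *)

Set Implicit Arguments.
Unset Strict Implicit.
Unset Printing Implicit Defensive.

Import Order.TTheory GRing.Theory Num.Theory.
Import numFieldNormedType.Exports.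
Local Open Scope classical_set_scope.
Local Open Scope ring_scope.
Local Open Scope complex_scope.

(** * Symmetric sums over the integers *)
Section IntegerSums.
Variable V : zmodType.
Implicit Types u v : int -> V.

Definition sympsum u (N : nat) : V := \sum_(i < (2 * N).+1) u (i%:Z - N%:Z).

(** A discrete primitive of u on all of Z, vanishing at 0. *)
Definition csum u (q : int) : V :=
  match q with
  | Posz n => \sum_(i < n) u i.+1%:Z
  | Negz n => - \sum_(i < n.+1) u (- i%:Z)
  end.

Lemma sympsum0 u : sympsum u 0 = u 0.
Proof. by rewrite /sympsum muln0 big_ord1 subrr. Qed.

Lemma sympsumS u N :
  sympsum u N.+1 = sympsum u N + (u N.+1%:Z + u (- N.+1%:Z)).
Proof.
rewrite /sympsum (_ : (2 * N.+1).+1 = (2 * N).+3)%N; last by lia.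
rewrite big_ord_recl big_ord_recr /= addrCA; congr (_ + _).
  by apply: eq_bigr => i _; rewrite /bump /=; congr (u _); lia.
rewrite addrC; congr (u _ + u _); last by rewrite sub0r.
by rewrite /bump /=; lia.
Qed.

Lemma csumS u q : csum u (q + 1) = csum u q + u (q + 1).
Proof.
case: q => n.
  rewrite (_ : Posz n + 1 = Posz n.+1); last by lia.
  by rewrite /= big_ord_recr.
case: n => [|n].
  by rewrite (_ : Negz 0 + 1 = 0)//= big_ord0 big_ord1 oppr0 addrC subrr.
rewrite (_ : Negz n.+1 + 1 = Negz n); last by lia.
rewrite /= [in RHS]big_ord_recr /= opprD -addrA.
rewrite (_ : - n.+1%:Z = Negz n) ?addNr ?addr0//; lia.
Qed.

Lemma sympsum_csum u N : sympsum u N = csum u N%:Z - csum u (- N%:Z - 1).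
Proof.
elim: N => [|N IH].
  by rewrite sympsum0 /= big_ord0 sub0r opprK big_ord1 oppr0.
rewrite sympsumS IH (_ : N.+1%:Z = N%:Z + 1); last by lia.
have -> : csum u (- N%:Z - 1) = csum u (- (N%:Z + 1) - 1) + u (- (N%:Z + 1)).
  have := csumS u (- (N%:Z + 1) - 1).
  by rewrite (_ : - (N%:Z + 1) - 1 + 1 = - N%:Z - 1) ?opprD//; lia.
rewrite csumS opprD -!addrA; congr (_ + _).
by rewrite [u _ + u _]addrC addKr addrC.
Qed.

Lemma sympsumD u v N :
  sympsum (fun n => u n + v n) N = sympsum u N + sympsum v N.
Proof. exact: big_split. Qed.

Lemma csumD u v q : csum (fun n => u n + v n) q = csum u q + csum v q.
Proof. by case: q => n /=; rewrite big_split //= opprD. Qed.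

Lemma sympsum_opp u N : sympsum (fun n => u (- n)) N = sympsum u N.
Proof.
elim: N => [|N IH]; first by rewrite !sympsum0 oppr0.
by rewrite !sympsumS IH opprK [u (- _) + _]addrC.
Qed.

End IntegerSums.

(** * Euler-Maclaurin summation against the sawtooth P1 *)
Section EulerMaclaurin.
Context {R : realType}.
Implicit Types (g h : R -> R) (x : R).
Notation mu := (@lebesgue_measure R).

Lemma P1_norm_le1 x : `|P1 x| <= 1.
Proof.
have /andP[] := floor_itv x; rewrite rmorphD /P1 ler_norml => h1 h2.
by apply/andP; split; lra.
Qed.

Lemma measurable_P1 D : measurable_fun D (@P1 R).
Proof.
apply: measurable_funTS.
have mfl : measurable_fun setT (fun x : R => (Num.floor x)%:~R : R).
  apply: nondecreasing_measurable => // x y xy.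
  by rewrite ler_int le_floor.
by do 2 apply: measurable_funB => //.
Qed.

Lemma P1_cell (n : int) x : n%:~R <= x < (n + 1)%:~R -> P1 x = x - n%:~R - 2^-1.
Proof. by move=> /floor_def; rewrite /P1 => ->. Qed.

(** A primitive of g + P1 g': the jumps of the sum at the integers cancel those
    of P1 g. *)
Definition em_prim g x : R :=
  csum (fun n : int => g n%:~R) (Num.floor x) + P1 x * g x.

(** The formula holds at both ends of the cell, the right one included: this is
    the cancellation of jumps. *)
Lemma em_prim_cell g (n : int) x : n%:~R <= x <= (n + 1)%:~R ->
  em_prim g x = csum (fun n : int => g n%:~R) n + (x - n%:~R - 2^-1) * g x.
Proof.
move=> /andP[nx]; rewrite le_eqVlt => /predU1P[->|xn1].
  rewrite /em_prim /P1 intrKfloor csumS.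
  rewrite rmorphD /=; lra.
by rewrite /em_prim (@floor_def _ x n) ?nx ?(@P1_cell n) ?nx.
Qed.

(** For x not an integer P1 is odd at x. For x an integer P1(x) = P1(-x) = -1/2
    and the sum over ]-x, x] misses the term at -x; the two effects compensate,
    so that a single formula covers the limit along all real x. *)
Lemma em_prim_sub_opp g (n : nat) x : n%:R <= x < n.+1%:R ->
  em_prim g x - em_prim g (- x) =
  sympsum (fun n : int => g n%:~R) n + P1 x * (g x + g (- x)).
Proof.
move=> /andP[nx xn].
have nxn : (n%:Z)%:~R <= x < (n%:Z + 1)%:~R.
  by rewrite -pmulrn nx rmorphD /= -pmulrn natr1.
have -> : em_prim g x = csum (fun n : int => g n%:~R) n + P1 x * g x.
  by rewrite /em_prim (@floor_def _ x n%:Z).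
rewrite (@em_prim_cell g (- n%:Z - 1)); last first.
  rewrite !rmorphD !rmorphN /= -pmulrn.
  by rewrite -natr1 in xn; apply/andP; split; lra.
rewrite sympsum_csum (@P1_cell n%:Z)//.
rewrite !rmorphB !rmorphN /= -pmulrn; lra.
Qed.

Lemma em_integrable (D : set R) g h : measurable D ->
  mu.-integrable D (EFin \o g) -> mu.-integrable D (EFin \o h) ->
  mu.-integrable D (EFin \o (fun x => g x + P1 x * h x)).
Proof.
move=> mD ig ih.
have ip : mu.-integrable D (EFin \o (fun x => P1 x * h x)).
  apply: le_integrable (ih) => //.
    apply/measurable_EFinP/measurable_funM; first exact: measurable_P1.
    by apply/measurable_EFinP; exact: (measurable_int mu ih).
  move=> x _ /=; rewrite lee_fin normrM ler_piMl//.
  exact: P1_norm_le1.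
by apply: (eq_integrable _ _ _ _ (integrableD _ ig ip)) => // x _ /=; rewrite EFinD.
Qed.

(** The Euler-Maclaurin identity on [a, b] for g and a function h in the role of
    its derivative. Being closed under sums and dominated limits, it passes to
    series without differentiating them. *)
Definition em_on g h (a b : R) : Prop :=
  mu.-integrable `[a, b] (EFin \o (fun x => g x + P1 x * h x)) /\
  \int[mu]_(x in `[a, b]) (g x + P1 x * h x) = em_prim g b - em_prim g a.

Lemma em_on_refl g h a : em_on g h a a.
Proof.
rewrite /em_on set_itv1 Rintegral_set1 subrr; split=> //.
apply: null_set_integrable => //; last exact: lebesgue_measure_set1.
exact: measurable_fun_set1.
Qed.

Lemma em_on_cell g h (n : int) (a b : R) : n%:~R <= a -> a < b -> b <= (n + 1)%:~R ->
  (forall x, a <= x <= b -> is_derive x 1 g (h x)) ->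
  (forall x, a <= x <= b -> {for x, continuous h}) ->
  mu.-integrable `[a, b] (EFin \o (fun x => g x + P1 x * h x)) ->
  em_on g h a b.
Proof.
move=> na ab bn dg ch ig; split=> //.
rewrite -Rintegral_itv_bndo_bndc; last first.
  by apply: integrableS ig => //; apply: subset_itvl; rewrite bnd_simp.
pose f x := g x + (x - n%:~R - 2^-1) * h x.
pose F x := (x - n%:~R - 2^-1) * g x.
have dF x : a <= x <= b -> is_derive x 1 F (f x).
  move=> /dg dgx; apply: is_derive_eq; rewrite /f scaler0 /GRing.scale /=; ring.
have cf x : a <= x <= b -> {for x, continuous f}.
  move=> xab; apply: cvgD; last first.
    apply: cvgM; last exact: ch.
    by apply: cvgB; [apply: cvgB; [exact: cvg_id|exact: cvg_cst]|exact: cvg_cst].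
  have := dg _ xab => /@ex_derive /derivable1_diffP /differentiable_continuous.
  exact.
have eqf : {in `[a, b[, (fun x => g x + P1 x * h x) =1 f}.
  move=> x; rewrite in_itv /= => /andP[ax xb].
  by rewrite /f (@P1_cell n)// (le_trans na ax) (lt_le_trans xb bn).
transitivity (\int[mu]_(x in `[a, b[) f x).
  by apply: eq_Rintegral => x; rewrite inE /=; exact: eqf.
have wcf : {within `[a, b], continuous f}.
  apply: continuous_in_subspaceT => x; rewrite inE /= in_itv /=; exact: cf.
have iff : mu.-integrable `[a, b] (EFin \o f).
  by apply: continuous_compact_integrable => //; exact: segment_compact.
rewrite Rintegral_itv_bndo_bndc; last first.
  by apply: integrableS iff => //; apply: subset_itvl; rewrite bnd_simp.
rewrite /Rintegral (@continuous_FTC2 _ f F)//.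
- rewrite -EFinD /= /F !(@em_prim_cell _ n) ?na ?bn ?(ltW (lt_le_trans ab bn))//.
    by rewrite !mulrBl; lra.
  by rewrite (le_trans na (ltW ab)).
- have cF x : a <= x <= b -> {for x, continuous F}.
    by move=> /dF /@ex_derive /derivable1_diffP /differentiable_continuous.
  split.
  + move=> x; rewrite in_itv /= => /andP[/ltW ax /ltW xb].
    by apply: ex_derive; apply: dF; rewrite ax xb.
  + by apply: cvg_at_right_filter; apply: cF; rewrite lexx ltW.
  + by apply: cvg_at_left_filter; apply: cF; rewrite lexx ltW.
- move=> x; rewrite in_itv /= => /andP[/ltW ax /ltW xb].
  by rewrite derive1E; apply: derive_val; apply: dF; rewrite ax xb.
Qed.

Lemma em_on_cat g h (a c b : R) : a <= c -> c <= b ->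
  mu.-integrable `[a, b] (EFin \o (fun x => g x + P1 x * h x)) ->
  em_on g h a c -> em_on g h c b -> em_on g h a b.
Proof.
move=> ac cb iab [iac eac] [icb ecb]; split=> //.
have := @Rintegral_itvB _ _ _ _ c iab.
rewrite !bnd_simp => /(_ ac cb); rewrite Rintegral_itv_obnd_cbnd.
  by rewrite eac ecb; lra.
by apply: integrableS icb => //; apply: subset_itvr; rewrite bnd_simp.
Qed.

(** By induction on the number of integers between a and b: the identity holds
    on each cell by the fundamental theorem of calculus. *)
Lemma em_derive g h (a b : R) : a <= b ->
  (forall x, a <= x <= b -> is_derive x 1 g (h x)) ->
  (forall x, a <= x <= b -> {for x, continuous h}) ->
  em_on g h a b.
Proof.
move=> ab dg ch.
have ig : mu.-integrable `[a, b] (EFin \o (fun x => g x + P1 x * h x)).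
  apply: em_integrable => //; apply: continuous_compact_integrable => //;
    try exact: segment_compact; apply: continuous_in_subspaceT => x;
    rewrite inE /= in_itv /= => xab; last exact: ch.
  by have := dg _ xab => /@ex_derive /derivable1_diffP /differentiable_continuous.
have sub c d : a <= c -> d <= b ->
    mu.-integrable `[c, d] (EFin \o (fun x => g x + P1 x * h x)).
  move=> ac db; apply: integrableS ig => //.
  move=> x; rewrite /= !in_itv /= => /andP[cx xd].
  by rewrite (le_trans ac) ?(le_trans xd).
suff H (k : nat) c : a <= c -> c <= b -> c <= (Num.floor a + 1 + k%:Z)%:~R ->
    em_on g h a c.
  apply: (H `|Num.floor b - Num.floor a|%N b) => //.
  have := le_floor ab; have /ltW := floorD1_gt b => /le_trans h1 h2; apply: h1.
  rewrite ler_int gez0_abs ?subr_ge0 //.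
  by set p := Num.floor a; set q := Num.floor b; lia.
elim: k c => [|k IH] c ac cb ck.
  move: ac; rewrite le_eqVlt => /predU1P[<-|ac]; first exact: em_on_refl.
  rewrite addr0 in ck; apply: (@em_on_cell _ _ (Num.floor a)) => //.
  + exact: floor_le.
  + by move=> x /andP[? xc]; apply: dg; apply/andP; split=> //; apply: le_trans cb.
  + by move=> x /andP[? xc]; apply: ch; apply/andP; split=> //; apply: le_trans cb.
  + exact: sub.
set d : R := (Num.floor a + 1 + k%:Z)%:~R in IH.
have [cd|dc] := leP c d; first exact: IH.
have ad : a <= d.
  by apply: le_trans (ltW (floorD1_gt a)) _; rewrite ler_int lerDl.
apply: (@em_on_cat _ _ _ d) => //; first exact: ltW.
- by apply: sub.
- by apply: IH => //; apply: le_trans (ltW dc) cb.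
apply: (@em_on_cell _ _ (Num.floor a + 1 + k%:Z)) => //.
+ by apply: le_trans ck _; rewrite ler_int; set p := Num.floor a; lia.
+ by move=> x /andP[? xc]; apply: dg; apply/andP;
       split; [exact: le_trans ad _|apply: le_trans cb].
+ by move=> x /andP[? xc]; apply: ch; apply/andP;
       split; [exact: le_trans ad _|apply: le_trans cb].
+ exact: sub.
Qed.

Lemma em_primD g1 g2 x :
  em_prim (fun x => g1 x + g2 x) x = em_prim g1 x + em_prim g2 x.
Proof. by rewrite /em_prim csumD; ring. Qed.

Lemma em_onD g1 h1 g2 h2 (a b : R) : em_on g1 h1 a b -> em_on g2 h2 a b ->
  em_on (fun x => g1 x + g2 x) (fun x => h1 x + h2 x) a b.
Proof.
move=> [i1 e1] [i2 e2].
have E x : g1 x + g2 x + P1 x * (h1 x + h2 x) =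
    (g1 x + P1 x * h1 x) + (g2 x + P1 x * h2 x) by ring.
split.
  apply: (eq_integrable _ _ _ _ (integrableD _ i1 i2)) => // x _ /=.
  by rewrite E EFinD.
transitivity (\int[mu]_(x in `[a, b]) ((g1 x + P1 x * h1 x) + (g2 x + P1 x * h2 x))).
  by apply: eq_Rintegral => x _; rewrite E.
by rewrite RintegralD// e1 e2 !em_primD; ring.
Qed.

Lemma em_on_sympsum (g h : int -> R -> R) (a b : R) (N : nat) :
  (forall n, em_on (g n) (h n) a b) ->
  em_on (fun x => sympsum (g^~ x) N) (fun x => sympsum (h^~ x) N) a b.
Proof.
move=> gh; elim: N => [|N IH].
  by under eq_fun do rewrite sympsum0;
     under [X in em_on _ X]eq_fun do rewrite sympsum0.
under eq_fun do rewrite sympsumS;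
under [X in em_on _ X]eq_fun do rewrite sympsumS.
by apply: em_onD => //; apply: em_onD.
Qed.

Lemma cvg_csum (u : nat -> int -> R) (v : int -> R) q :
  (forall n, u N n @[N --> \oo] --> v n) ->
  csum (u N) q @[N --> \oo] --> csum v q.
Proof.
move=> uv; case: q => n; last apply: cvgN.
  elim: n => [|n IH] /=.
    by under eq_fun do rewrite big_ord0; rewrite big_ord0; exact: cvg_cst.
  by under eq_fun do rewrite big_ord_recr /=; rewrite big_ord_recr /=; exact: cvgD.
elim: n.+1 => [|m IH] /=.
  by under eq_fun do rewrite big_ord0; rewrite big_ord0; exact: cvg_cst.
by under eq_fun do rewrite big_ord_recr /=; rewrite big_ord_recr /=; exact: cvgD.
Qed.

(** Dominated convergence on the left-hand side; the right-hand side involves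
    only the values of g at the ends and at the integers. *)
Lemma em_on_lim (gs hs : nat -> R -> R) g h (a b K : R) : a <= b ->
  (forall N, em_on (gs N) (hs N) a b) ->
  (forall N x, a <= x <= b -> `|gs N x| <= K) ->
  (forall N x, a <= x <= b -> `|hs N x| <= K) ->
  (forall x, a <= x <= b -> gs N x @[N --> \oo] --> g x) ->
  (forall x, a <= x <= b -> hs N x @[N --> \oo] --> h x) ->
  (forall n : int, gs N n%:~R @[N --> \oo] --> g n%:~R) ->
  em_on g h a b.
Proof.
move=> ab em gK hK gc hc gn.
have fc x : a <= x <= b ->
    gs N x + P1 x * hs N x @[N --> \oo] --> g x + P1 x * h x.
  by move=> xab; apply: cvgD; [exact: gc|apply: cvgM; [exact: cvg_cst|exact: hc]].
have pc x : a <= x <= b -> em_prim (gs N) x @[N --> \oo] --> em_prim g x.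
  move=> xab; apply: cvgD; first exact: cvg_csum.
  by apply: cvgM; [exact: cvg_cst|exact: gc].
have mf N : measurable_fun `[a, b] (fun x => gs N x + P1 x * hs N x).
  by apply/measurable_EFinP; have [/(measurable_int mu)] := em N.
have mab : measurable (`[a, b] : set R) by [].
have [|||||iF _ cF] := @dominated_convergence _ _ _ mu `[a, b] mab
   (fun N => EFin \o (fun x => gs N x + P1 x * hs N x))
   (EFin \o (fun x => g x + P1 x * h x)) (EFin \o cst (K + K)).
- by move=> N; apply/measurable_EFinP; exact: mf.
- apply/measurable_EFinP; apply: (measurable_fun_cvg mf) => x /=.
  by rewrite in_itv /=; exact: fc.
- apply: aeW => x; rewrite /= in_itv /= => xab.
  by apply: cvg_EFin; [exact: nearW|exact: fc].
- apply: continuous_compact_integrable; first exact: segment_compact.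
  by apply: continuous_subspaceT => x; exact: cvg_cst.
- apply: aeW => x N; rewrite /= in_itv /= => xab; rewrite lee_fin.
  apply: le_trans (ler_normD _ _) _; apply: lerD; first exact: gK.
  rewrite normrM; apply: le_trans (hK N x xab).
  by rewrite ler_piMl// P1_norm_le1.
split=> //.
have c1 : (\int[mu]_(x in `[a, b]) (gs N x + P1 x * hs N x))%R @[N --> \oo] -->
          (\int[mu]_(x in `[a, b]) (g x + P1 x * h x))%R.
  rewrite /Rintegral; apply: (fine_cvg (f := fun N => _)).
  by rewrite fineK//; exact: integrable_fin_num.
have c2 : (\int[mu]_(x in `[a, b]) (gs N x + P1 x * hs N x))%R @[N --> \oo] -->
          em_prim g b - em_prim g a.
  under eq_fun => N do rewrite (em N).2.
  by apply: cvgB; apply: pc; rewrite lexx ab.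
exact: cvg_unique c1 c2.
Qed.

End EulerMaclaurin.

(** * The majorant rho *)
Section Majorant.
Context {R : realType}.
Implicit Types s x y d : R.
Notation mu := (@lebesgue_measure R).

(** (1 + |s|)^(-3/2): the exponent is half of 3, so that weight 3 in two
    variables splits into a product of two summable factors. *)
Definition rho s : R := ((1 + `|s|) * Num.sqrt (1 + `|s|))^-1.

Let norm1_gt0 s : 0 < 1 + `|s|. Proof. by rewrite ltr_pwDl. Qed.

Let sqrt_ge1 s : 1 <= Num.sqrt (1 + `|s|).
Proof. by rewrite -[leLHS]sqrtr1 ler_wsqrtr// lerDl. Qed.

Let denom_gt0 s : 0 < (1 + `|s|) * Num.sqrt (1 + `|s|).
Proof. by rewrite mulr_gt0// sqrtr_gt0. Qed.

Lemma rho_gt0 s : 0 < rho s.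
Proof. by rewrite invr_gt0. Qed.

Lemma rho_ge0 s : 0 <= rho s.
Proof. exact/ltW/rho_gt0. Qed.

Lemma rhoN s : rho (- s) = rho s.
Proof. by rewrite /rho normrN. Qed.

Lemma rho_le_inv s : rho s <= (1 + `|s|)^-1.
Proof. by rewrite /rho lef_pV2 ?posrE// ler_peMr// ltW. Qed.

Lemma rho_le1 s : rho s <= 1.
Proof.
by apply: le_trans (rho_le_inv s) _; rewrite invf_le1// lerDl.
Qed.

Lemma inv_sqr_le_rho d s : 1 + `|s| <= d -> d^-1 ^+ 2 <= rho s.
Proof.
move=> sd; have d0 : 0 < d by apply: lt_le_trans sd.
rewrite exprVn /rho lef_pV2 ?posrE ?exprn_gt0//.
rewrite expr2 ler_pM// ?(ltW (norm1_gt0 _))// ?sqrtr_ge0//.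
apply: le_trans sd; rewrite -[leRHS](sqr_sqrtr (ltW (norm1_gt0 s))).
by rewrite expr2 ler_peMl// sqrtr_ge0.
Qed.

Lemma inv_cube_le_rho d x y : 1 + `|x| <= d -> 1 + `|y| <= d ->
  d^-1 ^+ 3 <= rho x * rho y.
Proof.
move=> xd yd; have d0 : 0 < d by apply: lt_le_trans xd.
rewrite exprVn /rho -invfM lef_pV2 ?posrE ?exprn_gt0// ?mulr_gt0//.
rewrite (_ : _ * _ * _ = (1 + `|x|) * (1 + `|y|) *
   (Num.sqrt (1 + `|x|) * Num.sqrt (1 + `|y|))); last by ring.
rewrite exprSr expr2 ler_pM ?mulr_ge0 ?sqrtr_ge0 ?(ltW (norm1_gt0 _))//.
  by rewrite ler_pM ?(ltW (norm1_gt0 _)).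
rewrite -sqrtrM ?(ltW (norm1_gt0 _))// -[leRHS](ger0_norm (ltW d0)) -(sqrtr_sqr d).
by rewrite ler_wsqrtr// expr2 ler_pM ?(ltW (norm1_gt0 _)).
Qed.

(** Comparison with the telescoping sum of 2 / sqrt(n + 1) - 2 / sqrt(n + 2). *)
Lemma sum_rho (N : nat) : \sum_(n < N) rho n.+1%:R <= 2.
Proof.
pose q (n : nat) : R := Num.sqrt n.+1%:R.
have q_gt0 n : 0 < q n by rewrite sqrtr_gt0.
have q2 n : q n ^+ 2 = n.+1%:R by rewrite sqr_sqrtr.
suff H : \sum_(n < N) rho n.+1%:R <= 2 - 2 / q N.
  by apply: le_trans H _; rewrite gerBl divr_ge0// ltW.
elim: N => [|N IH]; first by rewrite big_ord0 /q sqrtr1 divr1 subrr.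
rewrite big_ord_recr /=; apply: le_trans (lerD IH (lexx _)) _.
suff: rho N.+1%:R <= 2 / q N - 2 / q N.+1 by lra.
rewrite /rho ger0_norm// nat1r -/(q N.+1) -q2.
have := q2 N.+1; rewrite -natr1 -(q2 N).
move: (q_gt0 N) (q_gt0 N.+1); move: (q N) (q N.+1) => p r p0 r0 pr.
rewrite -mulrBr -[p^-1 - _]/(p^-1 - r^-1).
have -> : p^-1 - r^-1 = (r - p) / (p * r).
  by field; rewrite !gt_eqF.
have rp : (r - p) = (r + p)^-1.
  apply: (mulIf (lt0r_neq0 (addr_gt0 r0 p0))).
  by rewrite mulVf ?gt_eqF ?addr_gt0//; lra.
rewrite rp mulrA ler_pdivlMr ?mulr_gt0// mulrC.
rewrite ler_pdivrMr ?mulr_gt0 ?exprn_gt0// mulrAC ler_pdivlMr ?addr_gt0//.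
have pr' : p <= r by rewrite -(@ler_pXn2r _ 2) ?nnegrE ?ltW//; lra.
nra.
Qed.


Lemma continuous_rho : continuous rho.
Proof.
move=> x; apply: cvgV; first by rewrite gt_eqF.
have c : {for x, continuous (fun s : R => 1 + `|s|)}.
  by apply: cvgD; [exact: cvg_cst|exact: norm_continuous].
apply: cvgM => //.
by apply: (@continuous_comp _ _ _ (fun s : R => 1 + `|s|)) => //; exact: sqrt_continuous.
Qed.

Lemma measurable_rho : measurable_fun setT rho.
Proof. exact: continuous_measurable_fun continuous_rho. Qed.

(** The primitive of rho on the positive half-line is -2 / sqrt(1 + s). *)
Lemma integral_rho_lty : (\int[mu]_s (rho s)%:E < +oo)%E.
Proof.
rewrite ge0_symfun_integralT; first last.
- by move=> s /=; rewrite rhoN.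
- exact: continuous_rho.
- exact: rho_ge0.
pose F (s : R) := - (2 * (Num.sqrt (1 + s))^-1).
have dF (s : R) : 0 <= s -> is_derive s 1 F (rho s).
  move=> s0; have s1 : 0 < 1 + s by rewrite ltr_pwDl.
  have sq : Num.sqrt (1 + s) != 0 by rewrite gt_eqF// sqrtr_gt0.
  have d1 : is_derive s 1 (fun s : R => Num.sqrt (1 + s))
      ((2 * Num.sqrt (1 + s))^-1).
    have h : is_derive s 1 (fun s : R => 1 + s) 1.
      have := is_deriveD (is_derive_cst (1 : R) s (1 : R)) (is_derive_id s (1 : R)).
      by rewrite add0r.
    by have := is_derive1_comp (is_derive1_sqrt s1) h; rewrite mulr1.
  have d2 : is_derive s 1 (fun s : R => (Num.sqrt (1 + s))^-1)
      (- (Num.sqrt (1 + s)) ^- 2 *: (2 * Num.sqrt (1 + s))^-1).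
    exact: is_deriveV.
  have := is_deriveN (is_deriveZ 2 d2).
  move=> /is_derive_eq; apply.
  rewrite /rho (ger0_norm s0) /GRing.scale /=.
  have := sqr_sqrtr (ltW s1); move: sq; move: (Num.sqrt (1 + s)) => r r0 <-.
  by field.
rewrite -set_itvcy (@ge0_continuous_FTC2y _ _ F _ 0) //.
- by rewrite -EFinB -EFinM ltry.
- by move=> x _; exact: rho_ge0.
- by apply: continuous_subspaceT; exact: continuous_rho.
- apply/cvgrPdist_lt => e e0; near=> x.
  have xe : (2 / e) ^+ 2 < 1 + x.
    by rewrite -ltrBlDl; near: x; apply: nbhs_pinfty_gt; rewrite num_real.
  have x1 : 0 < 1 + x by apply: le_lt_trans xe; rewrite sqr_ge0.
  rewrite sub0r opprK ger0_norm ?mulr_ge0 ?invr_ge0 ?sqrtr_ge0//.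
  rewrite ltr_pdivrMr ?sqrtr_gt0// mulrC -ltr_pdivrMr//.
  rewrite -(@ltr_pXn2r _ 2)// ?nnegrE ?divr_ge0 ?sqrtr_ge0// ?ltW//.
  by rewrite sqr_sqrtr// ltW.
- by move=> x /ltW /dF /@ex_derive.
- apply: cvg_at_right_filter.
  by have := dF 0 (lexx _) => /@ex_derive /derivable1_diffP /differentiable_continuous.
- move=> x; rewrite in_itv /= andbT => /ltW x0; rewrite derive1E.
  by apply: derive_val; exact: dF.
Unshelve. all: by end_near. Qed.

Lemma integrable_rho : mu.-integrable setT (EFin \o rho).
Proof.
apply/integrableP; split; first by apply/measurable_EFinP; exact: measurable_rho.
under eq_integral do rewrite /= ger0_norm ?rho_ge0//.
exact: integral_rho_lty.
Qed.

Lemma integrable_rho2 :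
  (mu \x mu)%E.-integrable setT (fun p => (rho p.1 * rho p.2)%:E).
Proof.
have mr : measurable_fun setT (fun p : R * R => (rho p.1 * rho p.2)%:E).
  apply/measurable_EFinP; apply: measurable_funM.
    by apply: measurableT_comp => //; exact: measurable_rho.
  by apply: measurableT_comp => //; exact: measurable_rho.
apply/integrable12ltyP => //.
pose c : \bar R := (\int[mu]_s (rho s)%:E)%E.
have I : c \is a fin_num := integrable_fin_num measurableT integrable_rho.
have E x : (\int[mu]_y `|(rho x * rho y)%:E| = (rho x)%:E * c)%E.
  rewrite -ge0_integralZl//.
  - by apply: eq_integral => y _; rewrite abse_EFin ger0_norm ?mulr_ge0 ?rho_ge0.
  - by apply/measurable_EFinP; exact: measurable_rho.
  - by move=> y _; rewrite lee_fin rho_ge0.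
  - by rewrite lee_fin rho_ge0.
rewrite /=; under eq_integral do rewrite E.
rewrite ge0_integralZr//.
- by rewrite -/c -(fineK I) -EFinM ltry.
- by apply/measurable_EFinP; exact: measurable_rho.
- by move=> y _; rewrite lee_fin rho_ge0.
- by apply: integral_ge0 => x _; rewrite lee_fin rho_ge0.
Qed.

End Majorant.

(** * Complex-valued functions through real and imaginary parts *)
Section ComplexParts.
Context {R : realType}.
Implicit Types (z w u : R[i]).
Notation re := complex.Re.
Notation im := complex.Im.
Notation normc := Normc.normc.

Lemma creD z w : re (z + w) = re z + re w. Proof. by case: z; case: w. Qed.
Lemma creN z : re (- z) = - re z. Proof. by case: z. Qed.
Lemma creM z w : re (z * w) = re z * re w - im z * im w.
Proof. by case: z; case: w. Qed.
Lemma cimM z w : im (z * w) = re z * im w + im z * re w.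
Proof. by case: z; case: w. Qed.
Lemma cimD z w : im (z + w) = im z + im w. Proof. by case: z; case: w. Qed.
Lemma creV z : re z^-1 = re z * (re z ^+ 2 + im z ^+ 2)^-1.
Proof. by case: z. Qed.
Lemma cimV z : im z^-1 = - (im z * (re z ^+ 2 + im z ^+ 2)^-1).
Proof. by case: z. Qed.
(** Lets statements about Re (u * z), for all u, cover imaginary parts. *)
Lemma cimE z : im z = re (- 'i * z).
Proof. by case: z => p q; rewrite creM /=; ring. Qed.
Lemma creMr (r : R) z : re (r%:C * z) = r * re z.
Proof. by rewrite creM /= mul0r subr0. Qed.

Lemma normc_ge0 z : 0 <= normc z.
Proof. by case: z => p q; exact: sqrtr_ge0. Qed.

Lemma normcX z n : normc (z ^+ n) = normc z ^+ n.
Proof.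
elim: n => [|n IH]; first by rewrite !expr0 Normc.normc1.
by rewrite !exprS Normc.normcM IH.
Qed.

Lemma Re_le_normc z : `|re z| <= normc z.
Proof.
case: z => p q /=; rewrite -[leLHS]sqrtr_sqr ler_wsqrtr//.
by rewrite lerDl sqr_ge0.
Qed.

Lemma Im_le_normc z : `|im z| <= normc z.
Proof.
case: z => p q /=; rewrite -[leLHS]sqrtr_sqr ler_wsqrtr//.
by rewrite lerDr sqr_ge0.
Qed.

Lemma normc_le_parts z : normc z <= `|re z| + `|im z|.
Proof.
case: z => p q /=; rewrite -[leRHS]ger0_norm ?addr_ge0// -sqrtr_sqr.
rewrite ler_wsqrtr// sqrrD !real_normK ?num_real// addrAC lerDl.
by rewrite mulrn_wge0// mulr_ge0.
Qed.

Definition cderiv (f : R -> R[i]) (x : R) (l : R[i]) : Prop :=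
  is_derive x 1 (fun t => re (f t)) (re l) /\
  is_derive x 1 (fun t => im (f t)) (im l).

Lemma cderiv_cst u x : cderiv (cst u) x 0.
Proof. by split; exact: is_derive_cst. Qed.

Lemma cderiv_eq f x l l' : cderiv f x l -> l = l' -> cderiv f x l'.
Proof. by move=> ? <-. Qed.

Lemma cderiv_affine u w x : cderiv (fun t => u + t%:C * w) x w.
Proof.
split; [under eq_fun do rewrite creD creMr|
        under eq_fun do rewrite cimD cimM /= mul0r addr0];
apply: is_derive_eq; rewrite add0r ?scaler0 ?addr0 ?add0r /GRing.scale /=; ring.
Qed.

Lemma cderivM f g x l m : cderiv f x l -> cderiv g x m ->
  cderiv (fun t => f t * g t) x (f x * m + l * g x).
Proof.
move=> [f1 f2] [g1 g2]; split.
  under eq_fun do rewrite creM; apply: is_derive_eq.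
  by rewrite creD !creM /GRing.scale /=; ring.
under eq_fun do rewrite cimM; apply: is_derive_eq.
by rewrite cimD !cimM /GRing.scale /=; ring.
Qed.

Lemma sqr_parts_neq0 z : z != 0 -> re z ^+ 2 + im z ^+ 2 != 0.
Proof.
case: z => p q; apply: contra; rewrite /= paddr_eq0 ?sqr_ge0// !sqrf_eq0.
by move=> /andP[/eqP -> /eqP ->].
Qed.

Lemma cderivV f x l : f x != 0 -> cderiv f x l ->
  cderiv (fun t => (f t)^-1) x (- l * (f x)^-1 ^+ 2).
Proof.
move=> /sqr_parts_neq0 fx0 [f1 f2].
have d0 : is_derive x 1 (fun t => re (f t) ^+ 2 + im (f t) ^+ 2)
    (2 * re (f x) * re l + 2 * im (f x) * im l).
  by apply: is_derive_eq; rewrite /GRing.scale /=; ring.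
have d1 : is_derive x 1 (fun t => (re (f t) ^+ 2 + im (f t) ^+ 2)^-1)
    (- (re (f x) ^+ 2 + im (f x) ^+ 2) ^- 2 *:
      (2 * re (f x) * re l + 2 * im (f x) * im l)).
  exact: is_deriveV.
rewrite expr2; split.
  under eq_fun do rewrite creV; apply: is_derive_eq.
  rewrite !creM !cimM !creV !cimV creN (_ : im (- l) = - im l); last by case: (l).
  by rewrite /GRing.scale /=; field.
under eq_fun do rewrite cimV; apply: is_derive_eq.
rewrite !cimM !creM !creV !cimV creN (_ : im (- l) = - im l); last by case: (l).
by rewrite /GRing.scale /=; field.
Qed.

Lemma cderiv_invX f x l j : f x != 0 -> cderiv f x l ->
  cderiv (fun t => (f t ^+ j)^-1) x (- j%:R * l * (f x ^+ j.+1)^-1).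
Proof.
move=> fx0 fl; under eq_fun do rewrite -exprVn.
elim: j => [|j IH].
  under eq_fun do rewrite expr0; apply: cderiv_eq (cderiv_cst 1 x) _.
  by rewrite oppr0 !mul0r.
under eq_fun do rewrite exprS; apply: cderiv_eq (cderivM (cderivV fx0 fl) IH) _.
by rewrite !exprVn !exprS -!natr1; field; rewrite expf_neq0.
Qed.

Lemma cderiv_cvg f x l : cderiv f x l -> {for x, continuous (fun t => re (f t))}.
Proof.
by move=> [/@ex_derive /derivable1_diffP /differentiable_continuous].
Qed.

Section Measurability.
Context {d : measure_display} {T : measurableType d}.
Implicit Types f g : T -> R[i].

Definition cmeas f : Prop :=
  measurable_fun setT (fun t => re (f t)) /\ measurable_fun setT (fun t => im (f t)).

Lemma cmeas_cst u : cmeas (cst u). Proof. by split; exact: measurable_cst. Qed.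

Lemma cmeasD f g : cmeas f -> cmeas g -> cmeas (fun t => f t + g t).
Proof.
move=> [f1 f2] [g1 g2]; split.
  by under eq_fun do rewrite creD; exact: measurable_funD.
by under eq_fun do rewrite cimD; exact: measurable_funD.
Qed.

Lemma cmeasM f g : cmeas f -> cmeas g -> cmeas (fun t => f t * g t).
Proof.
move=> [f1 f2] [g1 g2]; split.
  under eq_fun do rewrite creM.
  by apply: measurable_funB; exact: measurable_funM.
under eq_fun do rewrite cimM.
by apply: measurable_funD; exact: measurable_funM.
Qed.

Lemma cmeas_real (f : T -> R) : measurable_fun setT f -> cmeas (fun t => (f t)%:C).
Proof. by move=> mf; split => //=; exact: measurable_cst. Qed.

Lemma cmeasV f : cmeas f -> cmeas (fun t => (f t)^-1).
Proof.
move=> [f1 f2].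
have m : measurable_fun setT (fun t => (re (f t) ^+ 2 + im (f t) ^+ 2)^-1).
  under eq_fun do rewrite -powR_inv1 ?addr_ge0 ?sqr_ge0//.
  apply: (@measurableT_comp _ _ _ _ _ _ (fun x : R => x `^ (-1))).
    exact: measurable_powR.
  by apply: measurable_funD; exact: measurable_funX.
split.
  by under eq_fun do rewrite creV; exact: measurable_funM.
by under eq_fun do rewrite cimV; apply: measurable_funN; exact: measurable_funM.
Qed.

Lemma cmeas_invX f j : cmeas f -> cmeas (fun t => (f t ^+ j)^-1).
Proof.
move=> mf; under eq_fun do rewrite -exprVn; elim: j => [|j IH].
  by under eq_fun do rewrite expr0; exact: cmeas_cst.
by under eq_fun do rewrite exprS; apply: cmeasM => //; exact: cmeasV.
Qed.

End Measurability.
End ComplexParts.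

(** * Bounds and derivatives of the lattice terms *)
Section LatticeEstimates.
Context {R : realType}.
Notation re := complex.Re.
Notation im := complex.Im.
Notation normc := Normc.normc.

(** With D the determinant of (w1, w2) over R, both s D and t D are real linear
    combinations of the parts of s w1 + t w2, with coefficients that do not
    depend on s and t. *)
Lemma lattice_coercive (w1 w2 : R[i]) : lattice_generators w1 w2 ->
  exists2 d : R, 0 < d &
  forall s t : R, d * (`|s| + `|t|) <= normc (s%:C * w1 + t%:C * w2).
Proof.
move=> indep.
pose D := re w1 * im w2 - im w1 * re w2.
have D0 : D != 0.
  apply/eqP => D0.
  have comb x y : x * re w1 + y * re w2 = 0 -> x * im w1 + y * im w2 = 0 ->
      x = 0 /\ y = 0.
    move=> h1 h2; apply: indep; apply/eqP; rewrite eq_complex.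
    by rewrite !creD !cimD !creM !cimM /= !mul0r !subr0 !addr0 h1 h2 eqxx.
  have [|| r0 p0] := comb (re w2) (- re w1); rewrite /D in D0; [ring|lra|].
  have [|| s0 q0] := comb (im w2) (- im w1); [lra|ring|].
  have [|| /eqP] := comb 1 0; [lra|lra|].
  by rewrite oner_eq0.
pose K := `|re w1| + `|im w1| + (`|re w2| + `|im w2|) + 1.
have K0 : 0 < K by rewrite ltr_wpDl// !addr_ge0.
exists (`|D| / K); first by rewrite divr_gt0// normr_gt0.
move=> s t; set z := s%:C * w1 + t%:C * w2.
have Rz : re z = s * re w1 + t * re w2 by rewrite creD !creMr.
have Iz : im z = s * im w1 + t * im w2.
  by rewrite cimD !cimM /= !mul0r !addr0.
have Es : s * D = im w2 * re z - re w2 * im z by rewrite Rz Iz /D; ring.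
have Et : t * D = re w1 * im z - im w1 * re z by rewrite Rz Iz /D; ring.
rewrite mulrAC ler_pdivrMr// mulrDr -!normrM ![D * _]mulrC Es Et.
have Hr := Re_le_normc z; have Hi := Im_le_normc z.
have H (a b x y : R) : `|x| <= normc z -> `|y| <= normc z ->
    `|a * x - b * y| <= (`|a| + `|b|) * normc z.
  move=> hx hy; apply: le_trans (ler_normB _ _) _.
  by rewrite !normrM mulrDl lerD// ler_wpM2l.
apply: le_trans (lerD (H _ _ _ _ Hr Hi) (H _ _ _ _ Hi Hr)) _.
rewrite -mulrDl mulrC ler_wpM2l ?normc_ge0// /K; lra.
Qed.

Variables (w1 w2 a : R[i]) (x0 y0 : R).
Hypothesis indep : lattice_generators w1 w2.
Hypothesis pole : x0%:C * w1 + y0%:C * w2 = - a.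

Let f := inv_pow w1 w2 a.

Lemma den_pole (x y : R) :
  a + x%:C * w1 + y%:C * w2 = (x - x0)%:C * w1 + (y - y0)%:C * w2.
Proof. by rewrite -[a]opprK -pole !rmorphB /=; ring. Qed.

Lemma den_neq0 (x y : R) : y != y0 -> a + x%:C * w1 + y%:C * w2 != 0.
Proof.
move=> yy0; apply/eqP; rewrite den_pole => /indep[_ /eqP].
by rewrite subr_eq0 (negPf yy0).
Qed.

(** Away from the row of the pole, the distance |x - x0| + |y - y0| dominates
    1 + |x| + |y|, because it is bounded below by eta. *)
Lemma inv_pow1_bound (eta : R) : 0 < eta -> exists2 C : R, 0 < C &
  forall x y, eta <= `|y - y0| -> normc (f 1 x y) <= C * (1 + `|x| + `|y|)^-1.
Proof.
move=> e0; have [d d0 co] := lattice_coercive indep.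
pose A := 1 + `|x0| + `|y0|.
have A0 : 0 < A by rewrite ltr_pwDl ?addr_ge0// ltr_pwDl.
exists ((A / eta + 1) / d).
  by rewrite divr_gt0// ltr_wpDl// divr_ge0// ltW.
move=> x y ey; rewrite /f /inv_pow expr1 Normc.normcV.
have := co (x - x0) (y - y0); rewrite -den_pole.
set n := normc _; set D := 1 + _ + _ => cn.
have D0 : 0 < D by rewrite ltr_pwDl ?addr_ge0// ltr_pwDl.
have st0 : 0 < `|x - x0| + `|y - y0|.
  by rewrite ltr_wpDl// (lt_le_trans e0).
have n0 : 0 < n by apply: lt_le_trans cn; rewrite mulr_gt0.
have DA : D <= (A / eta + 1) * (`|x - x0| + `|y - y0|).
  have h1 : `|x| <= `|x - x0| + `|x0|.
    by rewrite -{1}(subrK x0 x) ler_normD.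
  have h2 : `|y| <= `|y - y0| + `|y0|.
    by rewrite -{1}(subrK y0 y) ler_normD.
  have h3 : A <= A / eta * (`|x - x0| + `|y - y0|).
    rewrite mulrAC ler_pdivlMr// ler_pM2l//.
    by apply: le_trans ey _; rewrite lerDr.
  by rewrite mulrDl mul1r; apply: le_trans (lerD h3 (lexx _)); rewrite /D /A; lra.
rewrite -mulrA -invfM ler_pdivlMr ?mulr_gt0// mulrC ler_pdivrMr//.
apply: le_trans (ler_wpM2l (ltW d0) DA) _.
by rewrite mulrCA ler_wpM2l// ltW// ltr_wpDl// divr_ge0// ltW.
Qed.

Lemma normc_inv_pow j x y : normc (f j x y) = normc (f 1 x y) ^+ j.
Proof. by rewrite /f /inv_pow !Normc.normcV normcX expr1 exprVn. Qed.

Section Bounds.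
Variables (eta C : R).
Hypothesis C0 : 0 < C.
Hypothesis fC : forall x y, eta <= `|y - y0| ->
  normc (f 1 x y) <= C * (1 + `|x| + `|y|)^-1.

Let D_ge1 (x y : R) : 1 <= 1 + `|x| + `|y|.
Proof. by rewrite -addrA lerDl addr_ge0. Qed.

Let D_gt0 (x y : R) : 0 < 1 + `|x| + `|y|.
Proof. exact: lt_le_trans (D_ge1 _ _). Qed.

Let invD_le1 (x y : R) : (1 + `|x| + `|y|)^-1 <= 1.
Proof. by rewrite invf_le1. Qed.

Lemma inv_pow_bound j x y : eta <= `|y - y0| ->
  normc (f j x y) <= C ^+ j * (1 + `|x| + `|y|)^-1 ^+ j.
Proof.
move=> ey; rewrite normc_inv_pow -exprMn; apply: lerXn2r; rewrite ?nnegrE ?normc_ge0//.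
  by rewrite mulr_ge0 ?invr_ge0// ltW.
exact: fC.
Qed.

Lemma inv_pow_rho j x y : (2 <= j)%N -> eta <= `|y - y0| ->
  normc (f j x y) <= C ^+ j * rho x.
Proof.
move=> j2 ey; apply: le_trans (inv_pow_bound j x ey) _.
rewrite ler_pM2l ?exprn_gt0//.
apply: le_trans (inv_sqr_le_rho (_ : _ <= 1 + `|x| + `|y|)); last by rewrite lerDl.
by apply: ler_wiXn2l => //; rewrite ?invD_le1 ?invr_ge0 ?(ltW (D_gt0 _ _)).
Qed.

Lemma inv_pow_rho2 j x y : (3 <= j)%N -> eta <= `|y - y0| ->
  normc (f j x y) <= C ^+ j * (rho x * rho y).
Proof.
move=> j2 ey; apply: le_trans (inv_pow_bound j x ey) _.
rewrite ler_pM2l ?exprn_gt0//.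
apply: le_trans (inv_cube_le_rho (_ : _ <= 1 + `|x| + `|y|) _); last 2 first.
- by rewrite lerDl.
- by rewrite addrAC lerDl.
by apply: ler_wiXn2l => //; rewrite ?invD_le1 ?invr_ge0 ?(ltW (D_gt0 _ _)).
Qed.

Lemma inv_pow_bounded j x y : eta <= `|y - y0| -> normc (f j x y) <= C ^+ j.
Proof.
move=> ey; apply: le_trans (inv_pow_bound j x ey) _.
apply: ler_piMr; first by rewrite exprn_ge0// ltW.
by apply: exprn_ile1; rewrite ?invD_le1 ?invr_ge0 ?(ltW (D_gt0 _ _)).
Qed.

End Bounds.

(** The family of the real functions Re (u f_j) is closed under both partial
    derivatives, which raise j and multiply u by a constant. *)
Definition phi (u : R[i]) (j : nat) (x y : R) : R := re (u * f j x y).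

Lemma phi_le u j x y : `|phi u j x y| <= normc u * normc (f j x y).
Proof. by rewrite -Normc.normcM; exact: Re_le_normc. Qed.

Lemma phi_derive_x u j x y : y != y0 ->
  cderiv (fun x => u * f j x y) x (u * (- j%:R * w1 * f j.+1 x y)).
Proof.
move=> yy0.
have d1 : cderiv (fun x => a + x%:C * w1 + y%:C * w2) x w1.
  by under eq_fun do rewrite addrAC; exact: cderiv_affine.
have := cderivM (cderiv_cst u x) (cderiv_invX j (den_neq0 x yy0) d1).
by move/cderiv_eq; apply; rewrite mul0r addr0.
Qed.

Lemma phi_derive_y u j x y : y != y0 ->
  cderiv (fun y => u * f j x y) y (u * (- j%:R * w2 * f j.+1 x y)).
Proof.
move=> yy0.
have d1 : cderiv (fun y => a + x%:C * w1 + y%:C * w2) y w2 by exact: cderiv_affine.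
have := cderivM (cderiv_cst u y) (cderiv_invX j (den_neq0 x yy0) d1).
by move/cderiv_eq; apply; rewrite mul0r addr0.
Qed.

Definition dx_coef (j : nat) (u : R[i]) : R[i] := - j%:R * w1 * u.
Definition dy_coef (j : nat) (u : R[i]) : R[i] := - j%:R * w2 * u.

Lemma em_phi_x u j y (b c : R) : y != y0 -> b <= c ->
  em_on (phi u j ^~ y) (phi (dx_coef j u) j.+1 ^~ y) b c.
Proof.
move=> yy0 bc; apply: em_derive => // x _.
  have [/is_derive_eq + _] := phi_derive_x u j x yy0; apply.
  by rewrite /phi /dx_coef; congr re; ring.
exact: cderiv_cvg (phi_derive_x (dx_coef j u) j.+1 x yy0).
Qed.

Lemma em_phi_y u j x (b c : R) : b <= c -> c < y0 \/ y0 < b ->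
  em_on (phi u j x) (phi (dy_coef j u) j.+1 x) b c.
Proof.
move=> bc bcy0.
have neq y : b <= y <= c -> y != y0.
  move=> /andP[yb yc]; case: bcy0 => h; first by rewrite lt_eqF// (le_lt_trans yc).
  by rewrite gt_eqF// (lt_le_trans h).
apply: em_derive => // y /neq yy0.
  have [/is_derive_eq + _] := phi_derive_y u j x yy0; apply.
  by rewrite /phi /dy_coef; congr re; ring.
exact: cderiv_cvg (phi_derive_y (dy_coef j u) j.+1 x yy0).
Qed.

Lemma measurable_phi u j : measurable_fun setT (fun p : R * R => phi u j p.1 p.2).
Proof.
have m (w : R[i]) (g : R * R -> R) : measurable_fun setT g ->
    cmeas (fun p => (g p)%:C * w).
  by move=> mg; apply: cmeasM; [exact: cmeas_real|exact: cmeas_cst].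
suff [] : cmeas (fun p : R * R => u * f j p.1 p.2) by [].
apply: cmeasM; first exact: cmeas_cst.
apply: cmeas_invX; apply: cmeasD; last exact: m.
by apply: cmeasD; [exact: cmeas_cst|exact: m].
Qed.

Lemma measurable_phi_x u j y : measurable_fun setT (phi u j ^~ y).
Proof.
apply: (@measurableT_comp _ _ _ _ _ _ (fun p : R * R => phi u j p.1 p.2) _ (pair ^~ y)).
  exact: measurable_phi.
exact: measurable_pair2.
Qed.

End LatticeEstimates.

(** * Limits of symmetric sums *)
Section SymmetricLimits.
Context {R : realType}.

(** Only the paired terms u(n) + u(-n) need to be summable; this is what gives
    convergence in weight 1. *)
Lemma sympsum_dominated (u : int -> R) (r : nat -> R) (B : R) :
  (forall n, `|u n.+1%:Z + u (- n.+1%:Z)| <= r n) ->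
  (forall N, \sum_(n < N) r n <= B) ->
  cvgn (sympsum u) /\ forall N, `|sympsum u N| <= `|u 0| + B.
Proof.
move=> ur rB.
pose p n := u n.+1%:Z + u (- n.+1%:Z).
have E N : sympsum u N = u 0 + series p N.
  elim: N => [|N IH]; first by rewrite sympsum0 /series /= big_geq // addr0.
  by rewrite sympsumS IH /series /= big_nat_recr //= /p -!addrA.
have pB N : series (fun n => `|p n|) N <= B.
  apply: le_trans (rB N); rewrite /series /= big_mkord.
  by apply: ler_sum => i _; exact: ur.
split=> [|N].
  have cp : cvgn (series p).
    have : cvgn (series (fun n => `|p n|)).
      apply: nondecreasing_is_cvgn; last by exists B => _ [n _ <-]; exact: pB.
      by apply/nondecreasing_seqP => n; rewrite seriesSr lerDl.
    exact: normed_cvg.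
  apply/cvg_ex; exists (u 0 + limn (series p)).
  rewrite (_ : sympsum u = fun N => u 0 + series p N); last exact/funext.
  by apply: cvgD => //; exact: cvg_cst.
rewrite E; apply: le_trans (ler_normD _ _) _; rewrite lerD2l.
apply: le_trans (pB N); rewrite /series /=; exact: ler_norm_sum.
Qed.

(** The constant is 1 for the term at 0 and 2 * 2 for the two half-lines. *)
Lemma sympsum_rho (u : int -> R) (K : R) : (forall n, `|u n| <= K * rho n%:~R) ->
  forall N, `|sympsum u N| <= 5 * K.
Proof.
move=> uK N.
have K0 : 0 <= K.
  have := le_trans (normr_ge0 _) (uK 0); rewrite pmulr_lge0//; exact: rho_gt0.
have [|M|_ H] := @sympsum_dominated u (fun n => 2 * K * rho n.+1%:R) (4 * K).
- move=> n; apply: le_trans (ler_normD _ _) _.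
  apply: le_trans (lerD (uK _) (uK _)) _.
  by rewrite mulrNz rhoN -pmulrn; lra.
- rewrite -mulr_sumr (_ : 4 * K = 2 * K * 2); last by ring.
  by rewrite ler_wpM2l ?mulr_ge0// sum_rho.
apply: le_trans (H N) _; have := uK 0.
have : K * rho (0%:~R : R) <= K by rewrite ler_piMr// rho_le1.
lra.
Qed.

Lemma sympsum_telescope (v : int -> R) N :
  sympsum (fun n => v n - v (n + 1)) N = v (- N%:Z) - v (N%:Z + 1).
Proof.
elim: N => [|N IH]; first by rewrite sympsum0 oppr0.
rewrite sympsumS IH (_ : N%:Z + 1 = N.+1%:Z); last by lia.
rewrite (_ : - N.+1%:Z + 1 = - N%:Z); last by lia.
lra.
Qed.

Lemma cvg_em_prim_sym (g : R -> R) (l : R) :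
  sympsum (fun n : int => g n%:~R) N @[N --> \oo] --> l ->
  g x + g (- x) @[x --> +oo] --> (0 : R) ->
  em_prim g x - em_prim g (- x) @[x --> +oo] --> l.
Proof.
move=> gl g0; apply/cvgrPdist_lt => e e0.
have e2 : 0 < e / 2 by rewrite divr_gt0.
have [n0 _ Hn] := ((cvgrPdist_lt _ _).1 gl _ e2).
near=> x.
have x0 : 0 <= x by near: x; apply: nbhs_pinfty_ge; rewrite num_real.
have nx : n0%:R <= x by near: x; apply: nbhs_pinfty_ge; rewrite num_real.
have gx : `|0 - (g x + g (- x))| < e / 2.
  by near: x; exact: ((cvgrPdist_lt _ _).1 g0 _ e2).
have tx := truncn_itv x0.
rewrite (em_prim_sub_opp g tx) opprD addrA.
apply: le_lt_trans (ler_normB _ _) _; rewrite [ltRHS]splitr; apply: ltr_leD.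
  by apply: Hn; rewrite /= truncn_ge_nat.
rewrite sub0r normrN in gx; apply: le_trans (ltW gx).
by rewrite normrM ler_piMl// P1_norm_le1.
Unshelve. all: by end_near. Qed.

Lemma cvg_zero_bound (h : R -> R) (K : R) :
  (\forall x \near +oo, `|h x| <= K * (1 + `|x|)^-1) -> h x @[x --> +oo] --> (0 : R).
Proof.
move=> hK; apply/cvgrPdist_lt => e e0; near=> x.
rewrite sub0r normrN.
apply: (@le_lt_trans _ _ (K * (1 + `|x|)^-1)); first by near: x.
have x1 : 0 < 1 + `|x| by rewrite ltr_pwDl.
rewrite ltr_pdivrMr// mulrC -ltr_pdivrMr//.
have : K / e < x by near: x; apply: nbhs_pinfty_gt; rewrite num_real.
move=> /lt_le_trans; apply.
by apply: le_trans (ler_norm _) _; rewrite lerDr.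
Unshelve. all: by end_near. Qed.

End SymmetricLimits.

(** * Row sums *)
Section RowSums.
Context {R : realType}.
Notation re := complex.Re.
Notation im := complex.Im.
Notation normc := Normc.normc.
Notation mu := (@lebesgue_measure R).
Variables (w1 w2 a : R[i]) (x0 y0 : R).
Hypothesis indep : lattice_generators w1 w2.
Hypothesis pole : x0%:C * w1 + y0%:C * w2 = - a.
Notation f := (inv_pow w1 w2 a).
Notation phi := (phi w1 w2 a).

(** The row through y of the series defining Weil's function, cut off at N. *)
Definition rowpsum (u : R[i]) (j : nat) (y : R) (N : nat) : R :=
  sympsum (fun n : int => phi u j n%:~R y) N.

Definition rowsum (u : R[i]) (j : nat) (y : R) : R := limn (rowpsum u j y).

Lemma normcR (r : R) : normc r%:C = `|r|.
Proof. by rewrite /= expr0n addr0 sqrtr_sqr. Qed.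

Lemma addr_inv (z z' : R[i]) : z != 0 -> z' != 0 ->
  z^-1 + z'^-1 = (z + z') * (z^-1 * z'^-1).
Proof. by move=> z0 z0'; field; rewrite z0 z0'. Qed.

Let neq (eta y : R) : 0 < eta -> eta <= `|y - y0| -> y != y0.
Proof. by move=> e0; apply: contraTneq => ->; rewrite subrr normr0 -ltNge. Qed.

(** The bound is uniform in y on compact sets away from y0, as dominated
    convergence requires. In weight 1 the terms at n and -n are added first: their
    sum has a numerator independent of n over a denominator of weight 2. *)
Lemma rowpsum_bound u j (eta Y : R) : 0 < eta -> (1 <= j)%N -> exists K : R,
  forall y, eta <= `|y - y0| -> `|y| <= Y ->
    cvgn (rowpsum u j y) /\ forall N, `|rowpsum u j y N| <= K.
Proof.
move=> e0 j1; have [C C0 fC] := inv_pow1_bound indep pole e0.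
suff [B HB] : exists B : R, forall y, eta <= `|y - y0| -> `|y| <= Y ->
    forall n : nat, `|phi u j n.+1%:R y + phi u j (- n.+1%:R) y| <= B * rho n.+1%:R.
  exists (normc u * C ^+ j + B * 2) => y ey yY.
  have B0 : 0 <= B.
    have := le_trans (normr_ge0 _) (HB y ey yY 0); rewrite pmulr_lge0//.
    exact: rho_gt0.
  have [||cv bd] := @sympsum_dominated _ (fun n : int => phi u j n%:~R y)
      (fun n => B * rho n.+1%:R) (B * 2).
  - by move=> n; rewrite mulrNz -pmulrn; exact: HB.
  - by move=> N; rewrite -mulr_sumr ler_wpM2l// sum_rho.
  split=> // N; apply: le_trans (bd N) _; rewrite lerD2r.
  apply: le_trans (phi_le _ _ _ _ _ _ _) _; rewrite ler_wpM2l ?normc_ge0//.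
  exact: (inv_pow_bounded C0 fC).
case: j j1 => [//|[_|j _]].
  exists (normc u * (2 * (normc a + Y * normc w2)) * C ^+ 2) => y ey yY n.
  have yy0 := neq e0 ey.
  set x : R := n.+1%:R.
  rewrite /phi -creD -mulrDr /inv_pow !expr1 addr_inv ?(den_neq0 indep pole)//.
  rewrite (_ : _ + _ + _ = 2 * (a + y%:C * w2)); last by rewrite rmorphN; ring.
  apply: le_trans (Re_le_normc _) _; rewrite !Normc.normcM -!mulrA.
  rewrite ler_wpM2l ?normc_ge0//.
  have h2 : normc (2 : R[i]) = 2.
    by rewrite -(rmorph_nat (real_complex R) 2) normcR ger0_norm.
  rewrite h2 ler_pM2l//; apply: ler_pM; rewrite ?mulr_ge0 ?normc_ge0//.
    apply: le_trans (le_normcD _ _) _; rewrite lerD2l Normc.normcM.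
    by rewrite ler_wpM2r ?normc_ge0// normcR.
  have h x' : normc (a + x'%:C * w1 + y%:C * w2)^-1 <= C * (1 + `|x'| + `|y|)^-1.
    by have := fC x' y ey; rewrite /inv_pow expr1.
  apply: le_trans (ler_pM (normc_ge0 _) (normc_ge0 _) (h _) (h _)) _.
  rewrite mulrA normrN -!expr2 exprMn ler_wpM2l ?exprn_ge0 ?(ltW C0)//.
  by apply: inv_sqr_le_rho; rewrite lerDl.
exists (normc u * C ^+ j.+2 * 2) => y ey yY n.
apply: le_trans (ler_normD _ _) _.
apply: (@le_trans _ _ (normc u * C ^+ j.+2 * rho n.+1%:R +
                       normc u * C ^+ j.+2 * rho (- n.+1%:R))).
  by apply: lerD; apply: le_trans (phi_le _ _ _ _ _ _ _) _;
    rewrite -mulrA ler_wpM2l ?normc_ge0// (inv_pow_rho C0 fC).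
by rewrite rhoN; lra.
Qed.

Lemma cvg_rowpsum u j y : (1 <= j)%N -> y != y0 ->
  rowpsum u j y N @[N --> \oo] --> rowsum u j y.
Proof.
move=> j1 yy0.
have e0 : 0 < `|y - y0| by rewrite normr_gt0 subr_eq0.
have [K HK] := @rowpsum_bound u j _ `|y| e0 j1.
by have [] := HK y (lexx _) (lexx _).
Qed.

(** Integers y enter through the sums, hence the hypothesis that the row of the
    pole is not one of them. *)
Lemma em_rowsum u j (b c : R) : y0 \isn't a Num.int -> (1 <= j)%N ->
  b <= c -> c < y0 \/ y0 < b ->
  em_on (rowsum u j) (rowsum (dy_coef w2 j u) j.+1) b c.
Proof.
move=> y0i j1 bc bcy0.
have [eta e0 He] : exists2 eta : R, 0 < eta &
    forall y, b <= y <= c -> eta <= `|y - y0|.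
  case: bcy0 => h.
    exists (y0 - c); first by rewrite subr_gt0.
    by move=> y /andP[_ yc]; rewrite distrC; apply: le_trans (ler_norm _); lra.
  exists (b - y0); first by rewrite subr_gt0.
  by move=> y /andP[yb _]; apply: le_trans (ler_norm _); lra.
have HY y : b <= y <= c -> `|y| <= `|b| + `|c|.
  move=> /andP[yb yc]; rewrite ler_norml; have := ler_norm c.
  by have := ler_norm (- b); rewrite normrN => *; apply/andP; split;
    [have := normr_ge0 c; lra|have := normr_ge0 b; lra].
have [K1 HK1] := @rowpsum_bound u j eta (`|b| + `|c|) e0 j1.
have [K2 HK2] := @rowpsum_bound (dy_coef w2 j u) j.+1 eta (`|b| + `|c|) e0 isT.
apply: (@em_on_lim _ (fun N y => rowpsum u j y N)
   (fun N y => rowpsum (dy_coef w2 j u) j.+1 y N) _ _ _ _ (Num.max K1 K2)) => //.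
- by move=> N; apply: em_on_sympsum => n; apply: em_phi_y indep pole _ _ _ _ _ _ _.
- move=> N y ybc; rewrite le_max; apply/orP; left.
  by have [_] := HK1 y (He y ybc) (HY y ybc); apply.
- move=> N y ybc; rewrite le_max; apply/orP; right.
  by have [_] := HK2 y (He y ybc) (HY y ybc); apply.
- by move=> y ybc; apply: cvg_rowpsum => //; apply: neq (He y ybc).
- by move=> y ybc; apply: cvg_rowpsum => //; apply: neq (He y ybc).
- move=> n; apply: cvg_rowpsum => //.
  by apply: contraNneq y0i => <-; exact: intr_int.
Qed.

End RowSums.

(** * Line integrals along a row, and decay of row sums *)
Section LineAndDecay.
Context {R : realType}.
Notation re := complex.Re.
Notation im := complex.Im.
Notation normc := Normc.normc.
Notation mu := (@lebesgue_measure R).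

(** A value of the integral over the line as a symmetric limit; for k >= 3 the
    function is moreover Lebesgue integrable, so that both readings agree. *)
Definition has_line_integral (k : nat) (h : R -> R) (l : R) : Prop :=
  [/\ forall N : R, mu.-integrable `[- N, N] (EFin \o h),
      \int[mu]_(x in `[- N, N]) h x @[N --> +oo] --> l &
      (3 <= k)%N -> mu.-integrable setT (EFin \o h)].

Lemma has_line_integral_comb k (h1 h2 : R -> R) (l1 l2 c1 c2 : R) :
  has_line_integral k h1 l1 -> has_line_integral k h2 l2 ->
  has_line_integral k (fun x => c1 * h1 x + c2 * h2 x) (c1 * l1 + c2 * l2).
Proof.
move=> [i1 e1 s1] [i2 e2 s2].
have iD (D : set R) : measurable D -> mu.-integrable D (EFin \o h1) ->
    mu.-integrable D (EFin \o h2) ->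
    mu.-integrable D (EFin \o (fun x => c1 * h1 x)) /\
    mu.-integrable D (EFin \o (fun x => c2 * h2 x)) /\
    mu.-integrable D (EFin \o (fun x => c1 * h1 x + c2 * h2 x)).
  move=> mD I1 I2.
  have J1 : mu.-integrable D (EFin \o (fun x => c1 * h1 x)).
    by apply: (eq_integrable _ _ _ _ (integrableZl _ c1 I1)) => // x _ /=; rewrite EFinM.
  have J2 : mu.-integrable D (EFin \o (fun x => c2 * h2 x)).
    by apply: (eq_integrable _ _ _ _ (integrableZl _ c2 I2)) => // x _ /=; rewrite EFinM.
  split=> //; split=> //.
  by apply: (eq_integrable _ _ _ _ (integrableD _ J1 J2)) => // x _ /=; rewrite EFinD.
split.
- by move=> N; have [_ []] := iD _ (measurable_itv `[- N, N]) (i1 N) (i2 N).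
- have E N : \int[mu]_(x in `[- N, N]) (c1 * h1 x + c2 * h2 x) =
      c1 * \int[mu]_(x in `[- N, N]) h1 x + c2 * \int[mu]_(x in `[- N, N]) h2 x.
    have [J1 [J2 _]] := iD _ (measurable_itv `[- N, N]) (i1 N) (i2 N).
    by rewrite RintegralD// !RintegralZl.
  under eq_fun do rewrite E.
  by apply: cvgD; apply: cvgM => //; exact: cvg_cst.
- by move=> k3; have [_ []] := iD setT measurableT (s1 k3) (s2 k3).
Qed.

Variables (w1 w2 a : R[i]) (x0 y0 : R).
Hypothesis indep : lattice_generators w1 w2.
Hypothesis pole : x0%:C * w1 + y0%:C * w2 = - a.
Notation f := (inv_pow w1 w2 a).
Notation phi := (phi w1 w2 a).
Notation rowpsum := (rowpsum w1 w2 a).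
Notation rowsum := (rowsum w1 w2 a).

Let neq (eta y : R) : 0 < eta -> eta <= `|y - y0| -> y != y0.
Proof. by move=> e0; apply: contraTneq => ->; rewrite subrr normr0 -ltNge. Qed.

Lemma integrable_phi_x u j y : (2 <= j)%N -> y != y0 ->
  mu.-integrable setT (EFin \o (phi u j ^~ y)).
Proof.
move=> j2 yy0.
have e0 : 0 < `|y - y0| by rewrite normr_gt0 subr_eq0.
have [C C0 fC] := inv_pow1_bound indep pole e0.
apply: (le_integrable _ _ _ (integrableZl _ (normc u * C ^+ j) (@integrable_rho R))) => //.
  by apply/measurable_EFinP; exact: measurable_phi_x.
move=> x _ /=; rewrite lee_fin [leRHS]ger0_norm; last first.
  by rewrite !mulr_ge0 ?normc_ge0 ?exprn_ge0 ?rho_ge0 ?(ltW C0).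
apply: le_trans (phi_le _ _ _ _ _ _ _) _; rewrite -mulrA ler_wpM2l ?normc_ge0//.
exact: (inv_pow_rho C0 fC).
Qed.

(** Euler-Maclaurin summation on [-N, N]; the boundary terms vanish at infinity
    in every weight, 1 included. *)
Lemma row_line_integral k u j y : (1 <= j)%N -> (k <= j)%N -> y != y0 ->
  has_line_integral k (fun x => phi u j x y + P1 x * phi (dx_coef w1 j u) j.+1 x y)
    (rowsum u j y).
Proof.
move=> j1 kj yy0.
have em (b c : R) : b <= c ->
    em_on (phi u j ^~ y) (phi (dx_coef w1 j u) j.+1 ^~ y) b c.
  exact: em_phi_x indep pole _ _ _ _ _ yy0.
split.
- move=> N; have [NN|NN] := leP (- N) N; first exact: (em _ _ NN).1.
  by rewrite set_itv_ge ?bnd_simp -?ltNge//; exact: integrable_set0.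
- have cv : em_prim (phi u j ^~ y) N - em_prim (phi u j ^~ y) (- N)
      @[N --> +oo] --> rowsum u j y.
    apply: cvg_em_prim_sym; first exact: (cvg_rowpsum indep pole).
    have e0 : 0 < `|y - y0| by rewrite normr_gt0 subr_eq0.
    have [C C0 fC] := inv_pow1_bound indep pole e0.
    apply: (@cvg_zero_bound _ _ (2 * (normc u * C ^+ j))).
    apply: nearW => x; apply: le_trans (ler_normD _ _) _.
    have H x' : `|phi u j x' y| <= normc u * C ^+ j * (1 + `|x'|)^-1.
      apply: le_trans (phi_le _ _ _ _ _ _ _) _; rewrite -mulrA ler_wpM2l ?normc_ge0//.
      have x1 : 1 <= 1 + `|x'| by rewrite lerDl.
      have x10 : 0 < 1 + `|x'| by apply: lt_le_trans x1.
      apply: (@le_trans _ _ (C ^+ j * (1 + `|x'|)^-1 ^+ j)).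
        rewrite normc_inv_pow -exprMn; apply: lerXn2r.
        - by rewrite nnegrE normc_ge0.
        - by rewrite nnegrE mulr_ge0 ?invr_ge0 ?(ltW C0)// ltW.
        apply: le_trans (fC x' y (lexx _)) _; rewrite ler_wpM2l ?(ltW C0)//.
        by rewrite lef_pV2 ?posrE ?ltr_pwDl// lerDl.
      rewrite ler_wpM2l ?exprn_ge0 ?(ltW C0)//.
      rewrite -[leRHS]expr1; apply: ler_wiXn2l => //.
      by rewrite invf_le1.
    apply: le_trans (lerD (H _) (H _)) _; rewrite normrN; lra.
  apply: cvg_trans cv; apply: near_eq_cvg; near=> N.
  have N0 : 0 <= N by near: N; apply: nbhs_pinfty_ge; rewrite num_real.
  by rewrite (em _ _ _).2//; lra.
- move=> k3; have j2 : (2 <= j)%N by apply: leq_trans kj; apply: ltnW.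
  by apply: em_integrable => //; apply: integrable_phi_x => //; exact: ltnW.
Unshelve. all: by end_near. Qed.

Let limit_bound (u : nat -> R) (l B : R) :
  u N @[N --> \oo] --> l -> (forall N, `|u N| <= B) -> `|l| <= B.
Proof.
move=> /cvg_norm ul uB; apply: ler_cvg_to ul (cvg_cst B) _.
exact: nearW.
Qed.

(** In weight 3 and above each term is O(rho(n) rho(y)). In weight 2 it differs
    by as much from f1(n) f1(n + 1) = (f1(n) - f1(n + 1)) / w1, whose sum over n
    telescopes to 0. *)
Lemma rowsum_decay u j (eta : R) : 0 < eta -> (2 <= j)%N -> exists K : R,
  forall y, eta <= `|y - y0| -> `|rowsum u j y| <= K * rho y.
Proof.
move=> e0 j2; have [C C0 fC] := inv_pow1_bound indep pole e0.
have cv y : eta <= `|y - y0| -> rowpsum u j y N @[N --> \oo] --> rowsum u j y.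
  by move=> ey; apply: (cvg_rowpsum indep pole) (ltnW j2) (neq e0 ey).
move: j2; rewrite leq_eqVlt => /predU1P[j2|j3]; last first.
  exists (5 * (normc u * C ^+ j)) => y ey; apply: limit_bound (cv y ey) _ => N.
  rewrite -mulrA; apply: sympsum_rho => n.
  apply: le_trans (phi_le _ _ _ _ _ _ _) _.
  rewrite -!mulrA [rho y * _]mulrC ler_wpM2l ?normc_ge0//.
  exact: (inv_pow_rho2 C0 fC).
rewrite -{j}j2 in cv *.
have w10 : w1 != 0.
  apply/eqP => w10; have := @indep 1 0.
  by rewrite w10 mulr0 mul0r addr0 => /(_ erefl)[/eqP]; rewrite oner_eq0.
exists (5 * (normc (u * w1) * 2 * C ^+ 3)) => y ey.
have yy0 := neq e0 ey.
(* v(n) - v(n + 1) is the telescoping part of the term at n, r(n) the rest. *)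
pose v (n : int) : R := re (u / w1 * f 1 n%:~R y).
pose r (n : int) : R := re (u * w1 * (f 2 n%:~R y * f 1 (n + 1)%:~R y)).
have E N : rowpsum u 2 y N = (v (- N%:Z) - v (N%:Z + 1)) + sympsum r N.
  rewrite -sympsum_telescope -sympsumD; congr sympsum; apply/funext => n.
  rewrite /v /r /phi -creN -!creD; congr re; rewrite /inv_pow !expr1.
  have := den_neq0 indep pole n%:~R yy0; have := den_neq0 indep pole (n + 1)%:~R yy0.
  rewrite (_ : a + (n + 1)%:~R%:C * w1 + y%:C * w2 =
     (a + n%:~R%:C * w1 + y%:C * w2) + w1); last by rewrite !rmorphD /= rmorph1; ring.
  by move: (a + n%:~R%:C * w1 + y%:C * w2) => z z0 z0'; field; rewrite z0 z0' w10.
have v0 N : `|v (- N%:Z) - v (N%:Z + 1)| <= normc (u / w1) * C * 2 * (1 + N%:R)^-1.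
  have H (n : int) : (N%:R : R) <= `|n%:~R| ->
      `|v n| <= normc (u / w1) * C * (1 + N%:R)^-1.
    move=> Nn; apply: le_trans (phi_le _ _ _ _ _ _ _) _.
    rewrite -mulrA ler_wpM2l ?normc_ge0//; apply: le_trans (fC _ _ ey) _.
    rewrite ler_wpM2l ?(ltW C0)// lef_pV2 ?posrE ?ltr_pwDl ?addr_ge0//.
    by rewrite -addrA lerD2l ler_wpDr.
  apply: le_trans (ler_normB _ _) _; apply: le_trans (lerD (H _ _) (H _ _)) _.
  - by rewrite mulrNz normrN -pmulrn normr_nat.
  - by rewrite -intr_norm -pmulrn ler_nat; lia.
  - lra.
have r0 N : `|sympsum r N| <= 5 * (normc (u * w1) * 2 * C ^+ 3) * rho y.
  rewrite -mulrA; apply: sympsum_rho => n.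
  apply: le_trans (Re_le_normc _) _; rewrite Normc.normcM -!mulrA.
  rewrite ler_wpM2l ?normc_ge0//.
  set D := 1 + `|n%:~R| + `|y| : R.
  have D0 : 0 < D by rewrite ltr_pwDl ?addr_ge0// ltr_pwDl.
  have h2 := inv_pow_bound C0 fC 2 n%:~R ey.
  have h1 : normc (f 1 (n + 1)%:~R y) <= C * (2 * D^-1).
    apply: le_trans (fC _ _ ey) _; rewrite ler_wpM2l ?(ltW C0)//.
    rewrite ler_pdivlMr// mulrC ler_pdivrMr ?ltr_pwDl ?addr_ge0//.
    have : `|n%:~R : R| <= `|(n + 1)%:~R| + 1.
      rewrite -{1}(addrK 1 (n%:~R : R)) rmorphD /=.
      by apply: le_trans (ler_normB _ _) _; rewrite normr1.
    by rewrite /D; have := normr_ge0 y; have := normr_ge0 ((n + 1)%:~R : R); lra.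
  rewrite Normc.normcM; apply: le_trans (ler_pM (normc_ge0 _) (normc_ge0 _) h2 h1) _.
  rewrite (_ : _ * _ * _ = 2 * (C ^+ 3 * D^-1 ^+ 3)); last by ring.
  rewrite [leRHS](_ : _ = 2 * (C ^+ 3 * (rho n%:~R * rho y))); last by ring.
  rewrite ler_pM2l// ler_wpM2l ?exprn_ge0 ?(ltW C0)//.
  by apply: inv_cube_le_rho; rewrite /D ?lerDl// addrAC lerDl.
have cvE : (v (- N%:Z) - v (N%:Z + 1)) + sympsum r N @[N --> \oo] --> rowsum u 2 y.
  by under eq_fun do rewrite -E; exact: cv.
have v_cvg : v (- N%:Z) - v (N%:Z + 1) @[N --> \oo] --> (0 : R).
  apply/cvgrPdist_lt => e epos; near=> N.
  rewrite sub0r normrN; apply: le_lt_trans (v0 N) _.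
  rewrite ltr_pdivrMr ?ltr_pwDl// [ltRHS]mulrC -ltr_pdivrMr//.
  have : normc (u / w1) * C * 2 / e <= N%:R by near: N; exact: nbhs_infty_ger.
  by move=> /le_lt_trans; apply; rewrite ltrDr.
have r_cvg : sympsum r N @[N --> \oo] --> rowsum u 2 y.
  rewrite -[rowsum u 2 y]subr0; under eq_fun => N.
    rewrite (_ : sympsum r N = (v (- N%:Z) - v (N%:Z + 1)) + sympsum r N
       - (v (- N%:Z) - v (N%:Z + 1))); last by rewrite addrAC subrr add0r.
    over.
  exact: cvgB.
exact: limit_bound r_cvg r0.
Unshelve. all: by end_near. Qed.

(** In weight 1, with z = a + n w1 + y w2 and z' = 2a - z the denominator at
    (-n, -y), 1/z + 1/z' = -2a / z^2 + 4a^2 / (z^2 z'). *)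
Lemma rowsum_pair_decay u j (eta : R) : 0 < eta -> (1 <= j)%N -> exists K : R,
  forall y, eta <= `|y - y0| -> eta <= `|- y - y0| ->
    `|rowsum u j y + rowsum u j (- y)| <= K * rho y.
Proof.
move=> e0 j1; case: (ltnP 1 j) => [j2|j1'].
  have [K HK] := @rowsum_decay u j eta e0 j2.
  exists (K + K) => y ey eNy; apply: le_trans (ler_normD _ _) _.
  apply: le_trans (lerD (HK _ ey) (HK _ eNy)) _.
  by rewrite rhoN mulrDl.
have {j1 j1'} -> : j = 1%N by apply/eqP; rewrite eqn_leq j1' j1.
have [C C0 fC] := inv_pow1_bound indep pole e0.
have [K HK] := @rowsum_decay (- (2 * a) * u) 2 eta e0 isT.
exists (K + 5 * (normc (4 * a ^+ 2 * u) * C ^+ 3)) => y ey eNy.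
have yy0 := neq e0 ey; have Nyy0 := neq e0 eNy.
pose r (n : int) : R :=
  re (4 * a ^+ 2 * u * (f 2 n%:~R y * f 1 (- n)%:~R (- y))).
have E N : rowpsum u 1 y N + rowpsum u 1 (- y) N =
    rowpsum (- (2 * a) * u) 2 y N + sympsum r N.
  rewrite /rowpsum -[X in _ + X = _]sympsum_opp -!sympsumD.
  congr sympsum; apply/funext => n.
  rewrite /r /phi -!creD; congr re; rewrite /inv_pow !expr1.
  have := den_neq0 indep pole n%:~R yy0; have := den_neq0 indep pole (- n)%:~R Nyy0.
  rewrite (_ : a + (- n)%:~R%:C * w1 + (- y)%:C * w2 =
     2 * a - (a + n%:~R%:C * w1 + y%:C * w2)); last by rewrite !rmorphN /=; ring.
  by move: (a + n%:~R%:C * w1 + y%:C * w2) => z z0 z0'; field; rewrite z0 z0'.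
have r0 N : `|sympsum r N| <= 5 * (normc (4 * a ^+ 2 * u) * C ^+ 3) * rho y.
  rewrite -mulrA; apply: sympsum_rho => n.
  apply: le_trans (Re_le_normc _) _; rewrite Normc.normcM -!mulrA.
  rewrite ler_wpM2l ?normc_ge0//.
  set D := 1 + `|n%:~R| + `|y| : R.
  have D0 : 0 < D by rewrite ltr_pwDl ?addr_ge0// ltr_pwDl.
  have h2 := inv_pow_bound C0 fC 2 n%:~R ey.
  have h1 : normc (f 1 (- n)%:~R (- y)) <= C * D^-1.
    by apply: le_trans (fC _ _ eNy) _; rewrite mulrNz !normrN.
  rewrite Normc.normcM; apply: le_trans (ler_pM (normc_ge0 _) (normc_ge0 _) h2 h1) _.
  rewrite (_ : _ * _ * _ = C ^+ 3 * D^-1 ^+ 3); last by ring.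
  rewrite [leRHS](_ : _ = C ^+ 3 * (rho n%:~R * rho y)); last by ring.
  rewrite ler_wpM2l ?exprn_ge0 ?(ltW C0)//.
  by apply: inv_cube_le_rho; rewrite /D ?lerDl// addrAC lerDl.
have cv w i z : (1 <= i)%N -> z != y0 -> rowpsum w i z N @[N --> \oo] --> rowsum w i z.
  by move=> i1 zy0; exact: (cvg_rowpsum indep pole).
have r_cvg : sympsum r N @[N --> \oo] -->
    rowsum u 1 y + rowsum u 1 (- y) - rowsum (- (2 * a) * u) 2 y.
  under eq_fun => N.
    rewrite (_ : sympsum r N = rowpsum u 1 y N + rowpsum u 1 (- y) N -
       rowpsum (- (2 * a) * u) 2 y N); last by rewrite E addrAC subrr add0r.
    over.
  by apply: cvgB; [apply: cvgD|]; exact: cv.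
have := limit_bound r_cvg r0; have := HK y ey => h1 h2.
rewrite -[X in `|X|](subrK (rowsum (- (2 * a) * u) 2 y)).
by apply: le_trans (ler_normD _ _) _; rewrite [leRHS]mulrDl [leRHS]addrC lerD.
Qed.

End LineAndDecay.

(** * Limits in the complex plane *)
Section ComplexLimits.
Context {R : realType}.
Notation re := complex.Re.
Notation im := complex.Im.
Notation normc := Normc.normc.

Lemma cvg_complex (T : Type) (F : set_system T) {FF : Filter F}
    (h : T -> R[i]^o) (l : R[i]^o) :
  re (h t) @[t --> F] --> re l -> im (h t) @[t --> F] --> im l -> h @ F --> l.
Proof.
move=> hr hi; apply/cvgrPdist_lt => e e0.
have [er e0' eE] : exists2 r : R, 0 < r & e = r%:C.
  move: e0; case: e => r s; rewrite ltcE /= => /andP[/eqP -> r0]; by exists r.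
have e2 : 0 < er / 2 by rewrite divr_gt0.
have Hr := (cvgrPdist_lt _ _).1 hr _ e2; have Hi := (cvgrPdist_lt _ _).1 hi _ e2.
near=> t.
rewrite eE -[ltLHS]/((normc (l - h t))%:C) ltcR.
apply: le_lt_trans (normc_le_parts _) _; rewrite [ltRHS]splitr.
rewrite creD cimD creN (_ : im (- h t) = - im (h t)); last by case: (h t).
by apply: ltrD; [near: t; exact: Hr|near: t; exact: Hi].
Unshelve. all: by end_near. Qed.

Lemma lim_complex (T : Type) (F : set_system T) {FF : ProperFilter F}
    (h : T -> R[i]^o) (l : R[i]^o) : h @ F --> l -> lim (h @ F) = l.
Proof. by move=> hl; apply: cvg_lim => //; exact: norm_hausdorff. Qed.

Lemma re_sum (I : Type) (s : seq I) (P : pred I) (F : I -> R[i]) :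
  re (\sum_(i <- s | P i) F i) = \sum_(i <- s | P i) re (F i).
Proof. by elim/big_rec2: _ => // i x y _ <-; rewrite creD. Qed.

Lemma im_sum (I : Type) (s : seq I) (P : pred I) (F : I -> R[i]) :
  im (\sum_(i <- s | P i) F i) = \sum_(i <- s | P i) im (F i).
Proof. by elim/big_rec2: _ => // i x y _ <-; rewrite cimD. Qed.

Lemma symmetric_sum_complex (v : int -> R[i]^o) (p q : R) :
  sympsum (fun n => re (v n)) N @[N --> \oo] --> p ->
  sympsum (fun n => im (v n)) N @[N --> \oo] --> q ->
  symmetric_summable v /\ symmetric_sum v = p +i* q.
Proof.
move=> vp vq.
have cv : symmetric_psum v @ \oo --> (p +i* q : R[i]^o).
  apply: cvg_complex; rewrite /symmetric_psum /=.
    by under eq_fun do rewrite re_sum; exact: vp.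
  by under eq_fun do rewrite im_sum; exact: vq.
by split; [apply/cvg_ex; eexists; exact: cv|exact: lim_complex].
Qed.

End ComplexLimits.

(** * Integrals over the line and over half-planes *)
Section RealIntegralLimits.
Context {R : realType}.
Notation mu := (@lebesgue_measure R).

(** Dominated convergence for the restrictions of h to A n. *)
Lemma cvg_Rintegral_exhaust (D : set R) (A : nat -> set R) (h : R -> R) :
  measurable D -> (forall n, measurable (A n)) -> (forall n, A n `<=` D) ->
  (forall x, D x -> \forall n \near \oo, A n x) ->
  mu.-integrable D (EFin \o h) ->
  \int[mu]_(x in A n) h x @[n --> \oo] --> \int[mu]_(x in D) h x.
Proof.
move=> mD mA AD DA ih.
have mh : measurable_fun D h by apply/measurable_EFinP; exact: (measurable_int mu).
have E n : \int[mu]_(x in A n) h x = \int[mu]_(x in D) ((h \_ (A n)) x).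
  by rewrite -[in RHS]Rintegral_mkcondr setIidr.
under eq_fun do rewrite E.
have [|||||iF _ cF] := @dominated_convergence _ _ _ mu D mD
   (fun n => EFin \o (h \_ (A n))) (EFin \o h) (EFin \o (fun x => `|h x|)).
- move=> n; apply/measurable_EFinP.
  apply/(measurable_restrict h (mA n) mD); rewrite setIidr//.
  exact: measurable_funS mh.
- exact/measurable_EFinP.
- apply: aeW => x Dx; apply: cvg_near_cst.
  by near=> n; rewrite /= patchE mem_set//; near: n; exact: DA.
- exact: integrable_norm.
- apply: aeW => x n Dx; rewrite lee_fin patchE.
  by case: ifP => // _; rewrite normr0.
rewrite /Rintegral; apply: (fine_cvg (f := fun n => _)).
by rewrite fineK//; exact: integrable_fin_num.
Unshelve. all: by end_near. Qed.

Lemma has_line_integral_setT k (h : R -> R) (l : R) : (3 <= k)%N ->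
  has_line_integral k h l -> \int[mu]_x h x = l.
Proof.
move=> k3 [_ hl /(_ k3) ih].
have c1 : \int[mu]_(x in `[- n%:R, n%:R]) h x @[n --> \oo] --> \int[mu]_x h x.
  apply: cvg_Rintegral_exhaust => // x _.
  near=> n; rewrite /= in_itv /= -ler_norml; near: n; exact: nbhs_infty_ger.
have c2 : \int[mu]_(x in `[- n%:R, n%:R]) h x @[n --> \oo] --> l.
  by move/cvg_pinftyP : hl => /(_ (fun n => n%:R)); apply; exact: cvgr_idn.
exact: cvg_unique c1 c2.
Unshelve. all: by end_near. Qed.

Lemma line_integral_complex k (F : R -> R[i]) (l : R[i] -> R) :
  (forall u, has_line_integral k (fun x => complex.Re (u * F x)) (l u)) ->
  line_integrable k F /\ line_integral k F = l 1 +i* l (- 'i).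
Proof.
move=> Fl.
have Hr : has_line_integral k (fun x => complex.Re (F x)) (l 1).
  by have := Fl 1; under eq_fun do rewrite mul1r.
have Hi : has_line_integral k (fun x => complex.Im (F x)) (l (- 'i)).
  by have := Fl (- 'i); under eq_fun do rewrite -cimE.
have ri := Hr.  have ii := Hi.
move: Hr Hi => [r1 r2 r3] [i1 i2 i3].
have cv : (fun N : R => Defs.integral1 `[- N, N] F) @ +oo --> (l 1 +i* l (- 'i) : R[i]^o).
  by apply: cvg_complex.
rewrite /line_integrable /line_integral; case: ltnP => k3.
  split; first by split; [exact: r3|exact: i3].
  by rewrite /Defs.integral1 /Cintegral (has_line_integral_setT k3 ri)
    (has_line_integral_setT k3 ii).
split; last exact: lim_complex.
by split=> [N|]; [split; [exact: r1|exact: i1]|apply/cvg_ex; eexists; exact: cv].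
Qed.

Lemma is_cvg_sum_rho (p : nat -> R) (K : R) :
  (forall n, `|p n| <= K * rho n.+1%:R) -> cvgn (fun N => \sum_(i < N) p i).
Proof.
move=> pK.
pose u (q : int) : R := if q is Posz m.+1 then p m else 0.
have K0 : 0 <= K.
  have := le_trans (normr_ge0 _) (pK 0); rewrite pmulr_lge0//; exact: rho_gt0.
have [||cv _] := @sympsum_dominated _ u (fun n => K * rho n.+1%:R) (K * 2).
- by move=> n /=; rewrite addr0.
- by move=> N; rewrite -mulr_sumr ler_wpM2l// sum_rho.
rewrite (_ : (fun N => _) = sympsum u)//; apply/funext.
elim=> [|N IH]; first by rewrite big_ord0 sympsum0.
by rewrite big_ord_recr sympsumS /= IH addr0.
Qed.

Lemma is_cvg_em_prim (g : R -> R) (K : R) :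
  (forall n : nat, `|g n.+1%:R| <= K * rho n.+1%:R) ->
  (\forall x \near +oo, `|g x| <= K * rho x) ->
  cvg (em_prim g x @[x --> +oo]).
Proof.
move=> gn gx; have /cvg_ex[l cl] := is_cvg_sum_rho gn.
apply/cvg_ex; exists (l + 0).
have K0 : 0 <= K.
  have := le_trans (normr_ge0 _) (gn 0); rewrite pmulr_lge0//; exact: rho_gt0.
apply: cvgD; last first.
  apply: (@cvg_zero_bound _ _ K); near=> x.
  rewrite normrM; apply: (@le_trans _ _ `|g x|).
    by rewrite ler_piMl// P1_norm_le1.
  apply: (@le_trans _ _ (K * rho x)); first by near: x.
  by rewrite ler_wpM2l// rho_le_inv.
apply/cvgrPdist_lt => e e0.
have [n0 _ Hn] := (cvgrPdist_lt _ _).1 cl _ e0.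
near=> x.
have x0 : 0 <= x by near: x; apply: nbhs_pinfty_ge; rewrite num_real.
have nx : n0%:R <= x by near: x; apply: nbhs_pinfty_ge; rewrite num_real.
have tx := truncn_itv x0.
rewrite (@floor_def _ x (Num.truncn x)%:Z); last first.
  by rewrite -pmulrn rmorphD /= -pmulrn natr1.
have := Hn (Num.truncn x); rewrite /= truncn_ge_nat// => /(_ nx).
by under eq_bigr do rewrite pmulrn.
Unshelve. all: by end_near. Qed.

End RealIntegralLimits.

Section StripFubini.
Context {R : realType}.
Notation mu := (@lebesgue_measure R).

(** The hypothesis on l is about Rintegral, which is defined even for functions
    that are not integrable; integrability of each slice comes from the bound. *)
Lemma fubini_strip (D : set R) (h : R -> R -> R) (l : R -> R) (K : R) :
  measurable D -> measurable_fun setT (fun p : R * R => h p.1 p.2) ->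
  (forall x y, D y -> `|h x y| <= K * (rho x * rho y)) ->
  (forall y, D y -> \int[mu]_x h x y = l y) ->
  [/\ (mu \x mu)%E.-integrable (setT `*` D) (fun p => (h p.1 p.2)%:E),
      mu.-integrable D (EFin \o l) &
      \int[(mu \x mu)%E]_(p in setT `*` D) h p.1 p.2 = \int[mu]_(y in D) l y].
Proof.
move=> mD mh hK hl.
have mTD : measurable (setT `*` D : set (R * R)) by exact: measurableX.
have iTD : (mu \x mu)%E.-integrable (setT `*` D) (fun p => (h p.1 p.2)%:E).
  have iK : (mu \x mu)%E.-integrable (setT `*` D)
      (fun p => (K%:E * (rho p.1 * rho p.2)%:E)%E).
    by apply: integrableZl => //; apply: integrableS (@integrable_rho2 R).
  apply: (le_integrable _ _ _ iK) => //.
    by apply/measurable_EFinP; exact: measurable_funS mh.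
  move=> [x y] [_ /= Dy]; rewrite lee_fin.
  by apply: le_trans (hK x y Dy) _; exact: ler_norm.
pose H := (fun p : R * R => (h p.1 p.2)%:E) \_ (setT `*` D).
have iH : (mu \x mu)%E.-integrable setT H.
  by apply: (proj1 (integrable_mkcond _ _)) iTD.
have HD x y : D y -> H (x, y) = (h x y)%:E.
  by move=> Dy; rewrite /H patchE mem_set.
have HN x y : ~ D y -> H (x, y) = 0%:E.
  by move=> Dy; rewrite /H patchE memNset// => -[].
have ix y : D y -> mu.-integrable setT (EFin \o (h ^~ y)).
  move=> Dy; have iK : mu.-integrable setT
      (fun x => ((K * rho y)%:E * (rho x)%:E)%E).
    by apply: integrableZl => //; exact: integrable_rho.
  apply: (le_integrable _ _ _ iK) => //.
    apply/measurable_EFinP.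
    exact: (measurableT_comp mh (measurable_pair2 y)).
  move=> x _; rewrite lee_fin; apply: le_trans (hK x y Dy) _.
  by rewrite mulrCA mulrC; exact: ler_norm.
have G y : fubini_G mu H y = ((EFin \o l) \_ D) y.
  rewrite /fubini_G patchE; case: ifPn => [/set_mem Dy|/negP Dy].
    under eq_integral do rewrite HD//.
    rewrite /= -hl// /Rintegral fineK//; exact: integrable_fin_num (ix y Dy).
  transitivity (\int[mu]_(x in setT) (cst 0 x : \bar R))%E; last exact: integral0.
  by apply: eq_integral => x _; apply: HN => Dy'; apply: Dy; rewrite inE.
have GE : fubini_G mu H = (EFin \o l) \_ D by apply/funext.
have ml : measurable_fun D (EFin \o l).
  apply: (eq_measurable_fun (fubini_G mu H)).
    by move=> y Dy; rewrite GE patchE Dy.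
  by apply: measurable_funTS; exact: measurable_fubini_G iH.
split=> //.
  pose c : R := \int[mu]_x rho x.
  have iK : mu.-integrable D (fun y => ((K * c)%:E * (rho y)%:E)%E).
    by apply: integrableZl => //; apply: integrableS (@integrable_rho R).
  apply: (le_integrable _ _ _ iK); [by []|exact: ml|move=> y Dy; rewrite lee_fin].
  have ir : mu.-integrable setT (EFin \o (fun x => (K * rho y) * rho x)).
    apply: (eq_integrable _ _ _ _ (integrableZl _ (K * rho y) (@integrable_rho R))) => //.
  rewrite -hl//; apply: le_trans (le_normr_Rintegral _ (ix y Dy)) _ => //.
  apply: (@le_trans _ _ (\int[mu]_x ((K * rho y) * rho x))).
    apply: le_Rintegral => //; first exact: integrable_norm (ix y Dy).
    by move=> x _; apply: le_trans (hK x y Dy) _; rewrite -mulrA [rho y * _]mulrC.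
  by rewrite RintegralZl//; [rewrite -/c mulrAC; exact: ler_norm|exact: integrable_rho].
rewrite /Rintegral; congr fine.
rewrite [LHS]integral_mkcond [RHS]integral_mkcond -GE.
exact/esym/(integral21_prod_meas1 iH).
Qed.

End StripFubini.

(** * Unordered sums over pairs of integers *)
Section UnorderedSums.
Context {R : realType}.
#[local] Existing Instance summability.totally_filter.
Implicit Types (t : int * int -> R) (A : {fset int * int}).

Definition int_range (N : nat) : seq int :=
  [seq i%:Z - N%:Z | i <- iota 0 (2 * N).+1].

Lemma mem_int_range N (n : int) : (n \in int_range N) = (`|n| <= N)%N.
Proof.
apply/mapP/idP => [[k]|nN].
  by rewrite mem_iota => /andP[_ kN] ->; lia.
exists (absz (n + N%:Z)); last by lia.
by rewrite mem_iota; lia.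
Qed.

Lemma int_range_uniq N : uniq (int_range N).
Proof. by rewrite map_inj_uniq ?iota_uniq// => i j; lia. Qed.

Definition int_box (N M : nat) : seq (int * int) :=
  [seq (n, m) | n <- int_range N, m <- int_range M].

Lemma sum_int_box (t : int * int -> R) N M :
  \sum_(p <- int_box N M) t p =
  sympsum (fun m => sympsum (fun n => t (n, m)) N) M.
Proof.
have E (u : int -> R) K : \sum_(n <- int_range K) u n = sympsum u K.
  rewrite /int_range big_map /sympsum.
  by rewrite (_ : iota 0 (2 * K).+1 = index_iota 0 (2 * K).+1) ?big_mkord//
    /index_iota subn0.
rewrite big_allpairs exchange_big /= E; congr sympsum; apply/funext => m.
exact: E.
Qed.

Lemma int_box_uniq N M : uniq (int_box N M).
Proof. by apply: allpairs_uniq; rewrite ?int_range_uniq// => -[? ?] []. Qed.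

Lemma fset_sub_int_box A : exists N0 : nat, forall N M,
  (N0 <= N)%N -> (N0 <= M)%N -> {subset A <= int_box N M}.
Proof.
exists (\sum_(p <- A) (`|p.1| + `|p.2|))%N => N M hN hM p pA.
have : (`|p.1| + `|p.2| <= \sum_(p <- A) (`|p.1| + `|p.2|))%N.
  by rewrite (big_rem p) //= leq_addr.
case: p pA => n m pA /= H; apply/allpairsP; exists (n, m); split=> //=;
  rewrite mem_int_range; [apply: leq_trans hN|apply: leq_trans hM];
  by apply: leq_trans H; rewrite ?leq_addr ?leq_addl.
Qed.

Lemma ler_sum_sub (s1 s2 : seq (int * int)) t : uniq s1 -> uniq s2 ->
  {subset s1 <= s2} -> (forall p, 0 <= t p) ->
  \sum_(p <- s1) t p <= \sum_(p <- s2) t p.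
Proof.
move=> u1 u2 s12 t0; rewrite [leRHS](bigID (mem s1)) /=.
have -> : \sum_(p <- s2 | p \in s1) t p = \sum_(p <- s1) t p.
  rewrite -big_filter; apply: perm_big.
  apply: uniq_perm; rewrite ?filter_uniq// => p; rewrite mem_filter.
  by case: (boolP (p \in s1)) => // /s12 ->.
by rewrite lerDl sumr_ge0.
Qed.

Definition rho2 (p : int * int) : R := rho p.1%:~R * rho p.2%:~R.

Lemma sum_rho2 A : \sum_(p <- A) rho2 p <= 25.
Proof.
have [N /(_ N N (leqnn _) (leqnn _)) AN] := fset_sub_int_box A.
apply: le_trans (ler_sum_sub _ _ AN _) _; rewrite ?fset_uniq ?int_box_uniq//.
  by move=> p; rewrite mulr_ge0 ?rho_ge0.
rewrite sum_int_box.
have H (m : int) : `|sympsum (fun n => rho2 (n, m)) N| <= 5 * rho (m%:~R : R).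
  apply: sympsum_rho => n; rewrite /rho2 /= ger0_norm ?mulr_ge0 ?rho_ge0//.
  by rewrite mulrC.
apply: le_trans (ler_norm _) _.
by apply: le_trans (sympsum_rho H N) _; rewrite -natrM.
Qed.

Definition fsum t A : R := \sum_(p <- A) t p.

Lemma fsum_cvg_ge0 t (B : R) : (forall p, 0 <= t p) ->
  (forall A, fsum t A <= B) ->
  exists S : R, fsum t @ summability.totally --> S.
Proof.
move=> t0 tB; pose S := sup (range (fsum t)); exists S.
have hs : has_sup (range (fsum t)).
  by split; [exists (fsum t fset0); exists fset0|exists B => _ [A _ <-]].
apply/cvgrPdist_lt => e e0.
have [_ [A0 _ <-] hA0] := sup_adherent e0 hs.
exists A0 => // A /= A0A.
have h1 : fsum t A <= S by apply: ub_le_sup; [exact: hs.2|exists A].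
have h2 : fsum t A0 <= fsum t A.
  by apply: ler_sum_sub; rewrite ?fset_uniq//; exact/fsubsetP.
by rewrite ger0_norm ?subr_ge0//; rewrite -/S in hA0; lra.
Qed.

(** Both t + K rho2 and K rho2 are nonnegative with bounded finite sums, and t is
    their difference. *)
Lemma fsum_cvg t (K : R) : (forall p, `|t p| <= K * rho2 p) ->
  exists S : R, fsum t @ summability.totally --> S.
Proof.
move=> tK.
have K0 : 0 <= K.
  have := le_trans (normr_ge0 _) (tK (0, 0)); rewrite pmulr_lge0//.
  by rewrite mulr_gt0 ?rho_gt0.
have KB A : fsum (fun p => K * rho2 p) A <= K * 25.
  by rewrite /fsum -mulr_sumr ler_wpM2l// sum_rho2.
have tB p : - (K * rho2 p) <= t p <= K * rho2 p by rewrite -ler_norml.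
have [||S1 c1] := @fsum_cvg_ge0 (fun p => t p + K * rho2 p) (2 * K * 25).
- by move=> p; have := tB p => /andP[]; lra.
- move=> A; apply: (@le_trans _ _ (2 * fsum (fun p => K * rho2 p) A)).
    rewrite /fsum mulr_sumr; apply: ler_sum => p _.
    by have := tB p => /andP[]; lra.
  by have := KB A; lra.
have [||S2 c2] := @fsum_cvg_ge0 (fun p => K * rho2 p) (K * 25) => //.
  by move=> p; rewrite !mulr_ge0 ?rho_ge0.
exists (S1 - S2).
rewrite (_ : fsum t = fun A => fsum (fun p => t p + K * rho2 p) A -
   fsum (fun p => K * rho2 p) A).
  exact: cvgB.
apply/funext => A; rewrite /fsum -sumrB; apply: eq_bigr => p _; lra.
Qed.

Lemma cvg_sympsum (u : nat -> int -> R) (v : int -> R) M :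
  (forall m, u N m @[N --> \oo] --> v m) ->
  sympsum (u N) M @[N --> \oo] --> sympsum v M.
Proof.
move=> uv; elim: M => [|M IH].
  by rewrite sympsum0; under eq_fun do rewrite sympsum0; exact: uv.
rewrite sympsumS; under eq_fun do rewrite sympsumS.
by apply: cvgD => //; apply: cvgD.
Qed.

(** Boxes are cofinal among finite sets. A box of width N and height M large
    enough has a sum close to S; N tends to infinity first, then M. *)
Lemma fsum_iterated t (G : int -> R) (E S : R) :
  fsum t @ summability.totally --> S ->
  (forall m, sympsum (fun n => t (n, m)) N @[N --> \oo] --> G m) ->
  sympsum G M @[M --> \oo] --> E -> S = E.
Proof.
move=> tS tG GE.
suff H (e : R) : 0 < e -> `|S - E| <= e + e.
  apply/eqP; rewrite -subr_eq0 -normr_le0; apply/ler_addgt0Pr => e e0.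
  by rewrite add0r [leRHS]splitr; apply: H; rewrite divr_gt0.
move=> e0.
have [A0 _ HA0] := (cvgrPdist_lt _ _).1 tS _ e0.
have [n0 Hn0] := fset_sub_int_box A0.
have [M1 _ HM1] := (cvgrPdist_lt _ _).1 GE _ e0.
pose M := maxn n0 M1.
have hE : `|E - sympsum G M| < e by apply: HM1; rewrite /= leq_maxr.
have hS : `|S - sympsum G M| <= e.
  have c : sympsum (fun m => sympsum (fun n => t (n, m)) N) M @[N --> \oo]
      --> sympsum G M by exact: cvg_sympsum.
  have c' : `|S - sympsum (fun m => sympsum (fun n => t (n, m)) N) M|
      @[N --> \oo] --> `|S - sympsum G M|.
    by apply: cvg_norm; apply: cvgB => //; exact: cvg_cst.
  apply: ler_cvg_to c' (cvg_cst e) _.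
  near=> N; apply: ltW.
  have hN : (n0 <= N)%N by near: N; exact: nbhs_infty_ge.
  have := HA0 [fset p in int_box N M]%fset.
  rewrite /= /fsum (perm_big (int_box N M)) ?sum_int_box; first apply.
    by apply/fsubsetP => p pA; rewrite in_fset; apply: Hn0 => //; rewrite leq_maxl.
  apply: uniq_perm; rewrite ?fset_uniq ?int_box_uniq// => p.
  by rewrite in_fset.
rewrite -(subrKA (sympsum G M)); apply: le_trans (ler_normD _ _) _.
by apply: lerD => //; rewrite distrC ltW.
Unshelve. all: by end_near. Qed.

Lemma partial_sum_fsum (V : zmodType) (x : int * int -> V) A :
  summability.partial_sum x A = \sum_(p <- A) x p.
Proof. by rewrite big_seq_fsetE. Qed.

Lemma absolutely_summable_rho2 (v : int -> int -> R[i]^o) (K : R) :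
  (forall n m, Normc.normc (v n m) <= K * rho2 (n, m)) -> absolutely_summable v.
Proof.
move=> vK.
have K0 : 0 <= K.
  have := le_trans (normc_ge0 _) (vK 0 0); rewrite pmulr_lge0//.
  by rewrite mulr_gt0 ?rho_gt0.
rewrite /absolutely_summable /summable.
apply: (@le_lt_trans _ _ (K * 25)%:E); last exact: ltry.
apply: ub_ereal_sup => _ [X [/finite_fsetP[A ->] _] <-].
rewrite -fsbig_seq ?fset_uniq//.
apply: (@le_trans _ _ (\sum_(p <- A) (K * rho2 p)%:E)%E).
  apply: lee_sum => -[n m] _; rewrite abse_EFin lee_fin ger0_norm ?normc_ge0//.
by rewrite sumEFin lee_fin -mulr_sumr ler_wpM2l// sum_rho2.
Qed.

End UnorderedSums.

(** * The rows, summed *)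
Lemma int_gap {R : realType} (y0 : R) : y0 \isn't a Num.int ->
  exists2 eta : R, 0 < eta & forall m : int, eta <= `|m%:~R - y0|.
Proof.
move=> y0_nint; have /andP[fl fu] := floor_itv y0; set q := Num.floor y0 in fl fu.
have qy : q%:~R < y0.
  rewrite lt_neqAle fl andbT; apply: contraNneq y0_nint => <-; exact: intr_int.
exists (Num.min (y0 - q%:~R) ((q + 1)%:~R - y0)).
  by rewrite lt_min !subr_gt0 qy fu.
move=> m; rewrite ge_min; case: (lerP m q) => mq; apply/orP; [left|right].
  rewrite distrC; apply: le_trans (ler_norm _); rewrite lerD2l lerN2 ler_int//.
by apply: le_trans (ler_norm _); rewrite lerD2r ler_int lezD1.
Qed.

Section Assembly.
Context {R : realType}.
Notation re := complex.Re.
Notation im := complex.Im.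
Notation normc := Normc.normc.
Notation mu := (@lebesgue_measure R).

(** The complex number whose products with u have real part l u, when l is
    real-linear in u. *)
Definition of_parts (l : R[i] -> R) : R[i] := l 1 +i* l (- 'i).

Lemma of_partsD (l m : R[i] -> R) :
  of_parts l + of_parts m = of_parts (fun u => l u + m u).
Proof. by []. Qed.

Variables (w1 w2 a : R[i]) (k : nat) (x0 y0 : R).
Hypothesis indep : lattice_generators w1 w2.
Hypothesis pole : x0%:C * w1 + y0%:C * w2 = - a.
Hypothesis k_ge1 : (1 <= k)%N.
Hypothesis y0_nint : y0 \isn't a Num.int.

Notation phi := (phi w1 w2 a).
Notation rowsum := (rowsum w1 w2 a).
Notation prim u := (em_prim (rowsum u k)).
Notation J23 := (J23_integrand w1 w2 k a).

(** Re (u E_k(a, W)), see [weilE_rows_total]. *)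
Definition rows_total u : R := limn (sympsum (fun m : int => rowsum u k m%:~R)).

Lemma cvg_rows_total u :
  sympsum (fun m : int => rowsum u k m%:~R) N @[N --> \oo] --> rows_total u.
Proof.
have [eta e0 gap] := int_gap y0_nint.
have [K HK] := rowsum_pair_decay indep pole u e0 k_ge1.
have H (n : nat) : `|rowsum u k n.+1%:R + rowsum u k (- n.+1%:R)| <= K * rho n.+1%:R.
  by apply: HK; [have := gap n.+1%:Z|have := gap (- n.+1%:Z)]; rewrite ?mulrNz -pmulrn.
have K0 : 0 <= K.
  have := le_trans (normr_ge0 _) (H 0); rewrite pmulr_lge0//; exact: rho_gt0.
suff [] : cvgn (sympsum (fun m : int => rowsum u k m%:~R)) /\ forall N,
    `|sympsum (fun m : int => rowsum u k m%:~R) N| <= `|rowsum u k 0%:~R| + K * 2 by [].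
apply: (@sympsum_dominated _ _ (fun n => K * rho n.+1%:R)) => // N.
by rewrite -mulr_sumr ler_wpM2l// sum_rho.
Qed.

Let far (x : R) : `|y0| + 1 <= x -> 1 <= `|x - y0| /\ 1 <= `|- x - y0|.
Proof.
move=> hx; have := ler_norm y0; have := ler_norm (- y0); rewrite normrN => *.
split; first by apply: le_trans (ler_norm _); lra.
by rewrite -normrN; apply: le_trans (ler_norm _); lra.
Qed.

Lemma cvg_prim_sym u :
  prim u M - prim u (- M) @[M --> +oo] --> rows_total u.
Proof.
apply: cvg_em_prim_sym; first exact: cvg_rows_total.
have [K HK] := rowsum_pair_decay indep pole u ltr01 k_ge1.
apply: (@cvg_zero_bound _ _ `|K|); near=> x.
have [] : 1 <= `|x - y0| /\ 1 <= `|- x - y0|.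
  by apply: far; near: x; apply: nbhs_pinfty_ge; rewrite num_real.
move=> /HK /[apply] /le_trans; apply.
apply: (@le_trans _ _ (`|K| * rho x)).
  by rewrite ler_wpM2r ?rho_ge0 ?ler_norm.
by rewrite ler_wpM2l// rho_le_inv.
Unshelve. all: by end_near. Qed.

Definition prim_top u : R := lim (prim u M @[M --> +oo]).

Lemma cvg_prim_top u : (2 <= k)%N -> prim u M @[M --> +oo] --> prim_top u.
Proof.
move=> k2; have [eta e0 gap] := int_gap y0_nint.
have [K1 HK1] := rowsum_decay indep pole u e0 k2.
have [K2 HK2] := rowsum_decay indep pole u ltr01 k2.
apply: (@is_cvg_em_prim _ _ (Num.max K1 K2)).
  move=> n; have := gap n.+1%:Z; rewrite -pmulrn => /HK1 /le_trans; apply.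
  by rewrite ler_wpM2r ?rho_ge0// le_max lexx.
near=> x.
have [] : 1 <= `|x - y0| /\ 1 <= `|- x - y0|.
  by apply: far; near: x; apply: nbhs_pinfty_ge; rewrite num_real.
move=> /HK2 /le_trans + _; apply.
by rewrite ler_wpM2r ?rho_ge0// le_max lexx orbT.
Unshelve. all: by end_near. Qed.

Lemma cvg_prim_bot u : (2 <= k)%N ->
  prim u (- M) @[M --> +oo] --> prim_top u - rows_total u.
Proof.
move=> k2; rewrite (_ : (fun M => _) = fun M =>
    prim u M - (prim u M - prim u (- M))).
  by apply: cvgB; [exact: cvg_prim_top|exact: cvg_prim_sym].
by apply/funext => M; rewrite subKr.
Qed.

Lemma weil_inner (m : int) :
  symmetric_summable ((weil_term w1 w2 k a) ^~ m) /\
  symmetric_sum ((weil_term w1 w2 k a) ^~ m) =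
    of_parts (fun u => rowsum u k m%:~R).
Proof.
have my0 : m%:~R != y0.
  by apply: contraNneq y0_nint => <-; exact: intr_int.
have cv u : rowpsum w1 w2 a u k m%:~R N @[N --> \oo] --> rowsum u k m%:~R.
  exact: (cvg_rowpsum indep pole).
apply: symmetric_sum_complex.
  apply: cvg_trans (cv 1); apply: near_eq_cvg; apply: nearW => N.
  by congr sympsum; apply/funext => n; rewrite /phi mul1r.
apply: cvg_trans (cv (- 'i)); apply: near_eq_cvg; apply: nearW => N.
by congr sympsum; apply/funext => n; rewrite /phi -cimE.
Qed.

Lemma weilE_rows_total :
  weilE_converges w1 w2 k a /\ weilE w1 w2 k a = of_parts rows_total.
Proof.
rewrite /weilE_converges /weilE; case: ltnP => k3.
  have [eta e0 gap] := int_gap y0_nint.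
  have [C C0 fC] := inv_pow1_bound indep pole e0.
  have fb (n m : int) : normc (inv_pow w1 w2 a k n%:~R m%:~R) <= C ^+ k * rho2 (n, m).
    exact: (inv_pow_rho2 C0 fC).
  split; first exact: absolutely_summable_rho2 fb.
  have cv u : fsum (fun p => phi u k p.1%:~R p.2%:~R) @ summability.totally
      --> rows_total u.
    have [S cS] : exists S : R,
        fsum (fun p => phi u k p.1%:~R p.2%:~R) @ summability.totally --> S.
      apply: (@fsum_cvg _ _ (normc u * C ^+ k)) => -[n m].
      apply: le_trans (phi_le _ _ _ _ _ _ _) _; rewrite -mulrA.
      by rewrite ler_wpM2l ?normc_ge0.
    rewrite -(fsum_iterated cS _ (@cvg_rows_total u))// => m.
    apply: (cvg_rowpsum indep pole) => //.
    by apply: contraNneq y0_nint => <-; exact: intr_int.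
  apply: (@lim_complex _ _ _ (@summability.totally_filter (int * int)%type)).
  apply: cvg_complex.
  - exact: summability.totally_filter.
  - rewrite [X in X @ _](_ : _ = fsum (fun p => phi 1 k p.1%:~R p.2%:~R)).
      exact: cv.
    apply/funext => A; rewrite partial_sum_fsum re_sum; apply: eq_bigr => p _.
    by rewrite /phi mul1r.
  - rewrite [X in X @ _](_ : _ = fsum (fun p => phi (- 'i) k p.1%:~R p.2%:~R)).
      exact: cv.
    apply/funext => A; rewrite partial_sum_fsum im_sum; apply: eq_bigr => p _.
    by rewrite /phi -cimE.
have [] := @symmetric_sum_complex _
    (fun m => symmetric_sum ((weil_term w1 w2 k a) ^~ m))
    (rows_total 1) (rows_total (- 'i)).
- by under eq_fun do under eq_fun do rewrite (weil_inner _).2; exact: cvg_rows_total.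
- by under eq_fun do under eq_fun do rewrite (weil_inner _).2; exact: cvg_rows_total.
move=> s e; split; last exact: e.
by split; [move=> m; exact: (weil_inner m).1|exact: s].
Qed.

(** The integral over x of the integrand of J2 and J3, see [J23_line]. *)
Definition row_integral u (y : R) : R :=
  rowsum u k y + P1 y * rowsum (dy_coef w2 k u) k.+1 y.

Lemma Rintegral_row_integral u (b c : R) : b <= c -> c < y0 \/ y0 < b ->
  \int[mu]_(y in `[b, c]) row_integral u y = prim u c - prim u b.
Proof. by move=> bc bcy0; exact: (em_rowsum indep pole u y0_nint k_ge1 bc bcy0).2. Qed.

Let row_integrand u j (x y : R) : R :=
  phi u j x y + P1 x * phi (dx_coef w1 j u) j.+1 x y.

Lemma J23_parts u x y :
  re (u * J23 x y) =
  1 * row_integrand u k x y + P1 y * row_integrand (dy_coef w2 k u) k.+1 x y.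
Proof.
have E (r : R) z : r * re z = re (r%:C * z) by rewrite creMr.
rewrite /row_integrand /phi !E -!creD !E -!creD; congr re.
by rewrite /J23_integrand /dx_coef /dy_coef natrM -!natr1; ring.
Qed.

Lemma J23_line u y : y != y0 ->
  has_line_integral k (fun x => re (u * J23 x y)) (row_integral u y).
Proof.
move=> yy0; rewrite (_ : (fun x => _) = fun x =>
   1 * row_integrand u k x y +
   P1 y * row_integrand (dy_coef w2 k u) k.+1 x y); last first.
  by apply/funext => x; exact: J23_parts.
rewrite -[row_integral u y]/(rowsum u k y + _) -[rowsum u k y]mul1r.
by apply: has_line_integral_comb; exact: (row_line_integral indep pole).
Qed.

Lemma J1_line u (eps : R) : 0 < eps ->
  has_line_integral k (fun x => re (u * J1_integrand w1 w2 k a y0 eps x))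
   (P1 (y0 + eps) * rowsum u k (y0 + eps) +
    (- P1 (y0 - eps)) * rowsum u k (y0 - eps)).
Proof.
move=> e0; rewrite (_ : (fun x => _) = fun x =>
   P1 (y0 + eps) * row_integrand u k x (y0 + eps) +
   (- P1 (y0 - eps)) * row_integrand u k x (y0 - eps)); last first.
  apply/funext => x.
  have E (r : R) z : r * re z = re (r%:C * z) by rewrite creMr.
  rewrite /row_integrand /phi !E -!creD !E -!creD; congr re.
  by rewrite /J1_integrand /dx_coef rmorphN /=; ring.
apply: has_line_integral_comb; apply: (row_line_integral indep pole) => //.
  by rewrite gt_eqF// ltrDl.
by rewrite lt_eqF// ltrBlDr ltrDl.
Qed.

(** For b > c the strip is empty, which is why the position of y0 is only
    required when b <= c. *)
Lemma strip_J23 (b c : R) : (b <= c -> c < y0 \/ y0 < b) ->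
  strip_integrable k `[b, c] J23 /\
  (b <= c -> strip_integral k `[b, c] J23 =
             of_parts (fun u => prim u c - prim u b)).
Proof.
move=> bcy0.
have neq y : `[b, c]%classic y -> y != y0.
  rewrite /= in_itv /= => /andP[yb yc].
  case: (bcy0 (le_trans yb yc)) => h; first by rewrite lt_eqF// (le_lt_trans yc).
  by rewrite gt_eqF// (lt_le_trans h).
have line y : `[b, c]%classic y ->
    line_integrable k (J23 ^~ y) /\
    line_integral k (J23 ^~ y) = of_parts (fun u => row_integral u y).
  move=> /neq yy0; apply: (@line_integral_complex _ _ _ (fun u => row_integral u y)).
  by move=> u; exact: J23_line.
have em u : b <= c -> em_on (rowsum u k) (rowsum (dy_coef w2 k u) k.+1) b c.
  by move=> bc; apply: (em_rowsum indep pole) => //; exact: bcy0.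
have ri u : mu.-integrable `[b, c] (EFin \o row_integral u).
  have [bc|bc] := leP b c; first exact: (em u bc).1.
  by rewrite set_itv_ge ?bnd_simp -?ltNge//; exact: integrable_set0.
split.
  split=> [y /line[]//|].
  split; [apply: (eq_integrable _ _ _ _ (ri 1)) => //|
          apply: (eq_integrable _ _ _ _ (ri (- 'i))) => //];
    by move=> y /set_mem /line[_ /= ->].
move=> bc; rewrite /strip_integral /Defs.integral1 /Cintegral /of_parts.
rewrite -!(em _ bc).2; congr (_ +i* _); apply: eq_Rintegral;
  by move=> y /set_mem /line[_ ->].
Qed.

(** By Fubini the double integral is the integral over D of the row integrals,
    which are already known on the exhausting strips A n. *)
Lemma half_plane_J23 (D : set R) (eta : R) (A : nat -> set R) (l : R[i] -> R) :
  (3 <= k)%N -> 0 < eta -> measurable D -> (forall y, D y -> eta <= `|y - y0|) ->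
  (forall n, measurable (A n)) -> (forall n, A n `<=` D) ->
  (forall y, D y -> \forall n \near \oo, A n y) ->
  (forall u, \int[mu]_(y in A n) row_integral u y @[n --> \oo] --> l u) ->
  integrable2 (setT `*` D) J23 /\ integral2 (setT `*` D) J23 = of_parts l.
Proof.
move=> k3 e0 mD De mA AD DA Al.
have [C C0 fC] := inv_pow1_bound indep pole e0.
have neq y : D y -> y != y0.
  move=> /De; apply: contraTneq => ->; rewrite subrr normr0 -ltNge//.
have mphi v j : measurable_fun setT (fun p : R * R => phi v j p.1 p.2).
  exact: measurable_phi.
have mP1 (q : R * R -> R) : measurable_fun setT q ->
    measurable_fun setT (fun p => P1 (q p)).
  by move=> mq; apply: measurableT_comp mq; exact: measurable_P1.
have mrow v j : measurable_fun setT (fun p : R * R => row_integrand v j p.1 p.2).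
  apply: measurable_funD; first exact: mphi.
  by apply: measurable_funM; [exact: mP1|exact: mphi].
have bphi v j x y : (3 <= j)%N -> D y ->
    `|phi v j x y| <= normc v * C ^+ j * (rho x * rho y).
  move=> j3 /De ye; apply: le_trans (phi_le _ _ _ _ _ _ _) _.
  by rewrite -mulrA ler_wpM2l ?normc_ge0//; exact: (inv_pow_rho2 C0 fC).
have bP1 (y r : R) : `|P1 y * r| <= `|r|.
  by rewrite normrM ler_piMl// P1_norm_le1.
have brow v j : (3 <= j)%N -> exists K, forall x y, D y ->
    `|row_integrand v j x y| <= K * (rho x * rho y).
  move=> j3; exists (normc v * C ^+ j + normc (dx_coef w1 j v) * C ^+ j.+1) => x y Dy.
  apply: le_trans (ler_normD _ _) _; rewrite [leRHS]mulrDl; apply: lerD.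
    exact: bphi.
  by apply: le_trans (bP1 _ _) _; apply: bphi => //; exact: ltnW.
have H u : [/\ (mu \x mu)%E.-integrable (setT `*` D)
        (fun p => (re (u * J23 p.1 p.2))%:E),
      mu.-integrable D (EFin \o row_integral u) &
      \int[(mu \x mu)%E]_(p in setT `*` D) re (u * J23 p.1 p.2) =
      \int[mu]_(y in D) row_integral u y].
  have [K1 HK1] := brow u k k3.
  have [K2 HK2] := brow (dy_coef w2 k u) k.+1 (ltnW k3).
  apply: (@fubini_strip _ D (fun x y => re (u * J23 x y)) _ (K1 + K2)) => //.
  - under eq_fun do rewrite J23_parts mul1r.
    apply: measurable_funD; first exact: mrow.
    by apply: measurable_funM; [exact: mP1|exact: mrow].
  - move=> x y Dy; rewrite J23_parts mul1r; apply: le_trans (ler_normD _ _) _.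
    rewrite [leRHS]mulrDl; apply: lerD; first exact: HK1.
    by apply: le_trans (bP1 _ _) _; exact: HK2.
  - move=> y Dy; apply: (has_line_integral_setT k3); apply: J23_line; exact: neq.
have lE u : \int[mu]_(y in D) row_integral u y = l u.
  have c : \int[mu]_(y in A n) row_integral u y @[n --> \oo] -->
      \int[mu]_(y in D) row_integral u y.
    by apply: cvg_Rintegral_exhaust => //; have [] := H u.
  exact: cvg_unique c (Al u).
have [i1 _ e1] := H 1; have [i2 _ e2] := H (- 'i).
have r1 : (fun p : R * R => re (1 * J23 p.1 p.2)) = (fun p => re (J23 p.1 p.2)).
  by apply/funext => p; rewrite mul1r.
have r2 : (fun p : R * R => re (- 'i * J23 p.1 p.2)) = (fun p => im (J23 p.1 p.2)).
  by apply/funext => p; rewrite -cimE.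
split.
  split; first by move: i1; under eq_fun do rewrite mul1r.
  by move: i2; under eq_fun do rewrite -cimE.
by rewrite /integral2 /Cintegral /of_parts -!lE -e1 -e2 r1 r2.
Qed.

Lemma cvg_of_parts (h : R -> R[i]^o) (l : R[i] -> R) (p : R[i] -> R -> R) :
  (\forall M \near +oo, h M = of_parts (p ^~ M)) ->
  (forall u, p u M @[M --> +oo] --> l u) ->
  h @ +oo --> (of_parts l : R[i]^o).
Proof.
move=> hp pl; apply: cvg_complex.
  apply: cvg_trans (pl 1); apply: near_eq_cvg; near=> M.
  by have -> : h M = of_parts (p ^~ M) by near: M.
apply: cvg_trans (pl (- 'i)); apply: near_eq_cvg; near=> M.
by have -> : h M = of_parts (p ^~ M) by near: M.
Unshelve. all: by end_near. Qed.

End Assembly.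

Theorem corollary1p4 (R : realType) (w1 w2 : R[i]) (k : nat) (a : R[i])
    (x0 y0 : R) :
  lattice_generators w1 w2 ->
  (1 <= k)%N ->
  ~ lattice w1 w2 a ->
  x0%:C * w1 + y0%:C * w2 = - a ->
  y0 \isn't a Num.int ->
  weilE_converges w1 w2 k a /\
  \forall eps \near 0^'+,
    [/\ J1_converges w1 w2 k a y0 eps,
        k = 1%N ->
          J23_pv_converges w1 w2 k a y0 eps /\
          weilE w1 w2 k a = J1 w1 w2 k a y0 eps + J23_pv w1 w2 k a y0 eps &
        (2 <= k)%N ->
          [/\ J2_converges w1 w2 k a y0 eps,
              J3_converges w1 w2 k a y0 eps &
              weilE w1 w2 k a =
                J1 w1 w2 k a y0 eps + J2 w1 w2 k a y0 eps
                + J3 w1 w2 k a y0 eps]].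
Proof.
move=> indep k1 _ pole y0i.
have [wc wE] := weilE_rows_total indep pole k1 y0i.
split=> //; rewrite wE.
have [eta eta0 gap] := int_gap y0i.
near=> eps.
have e0 : 0 < eps by near: eps; exact: nbhs_right_gt.
have ee : eps < eta by near: eps; exact: nbhs_right_lt.
set c := y0 + eps; set d := y0 - eps.
have yc : y0 < c by rewrite ltrDl.
have d_lt : d < y0 by rewrite ltrBlDr ltrDl.
pose p u := em_prim (rowsum w1 w2 a u k).
pose tot := rows_total w1 w2 a k; pose tp := prim_top w1 w2 a k.
(* The interval [y0 - eps, y0 + eps] contains no integer. *)
have flE : Num.floor c = Num.floor d.
  have /andP[fl fu] := floor_itv y0; set q := Num.floor y0 in fl fu.
  have g1 := gap q; have g2 := gap (q + 1).
  rewrite distrC ger0_norm ?subr_ge0// in g1.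
  rewrite ger0_norm ?subr_ge0 ?(ltW fu)// in g2.
  rewrite (@floor_def _ c q) ?(@floor_def _ d q)//; apply/andP; split.
  - by rewrite /d; lra.
  - exact: lt_trans fu.
  - exact: le_trans fl (ltW yc).
  - by rewrite /c; lra.
have outer_parts (A B C D : R) : A - B + (C - D) = A - D - (B - C) by ring.
have all_parts (A B C D : R) : A - B + (C - A) + (B - (C - D)) = D by ring.
have J1E u : P1 c * rowsum w1 w2 a u k c + (- P1 d) * rowsum w1 w2 a u k d =
    p u c - p u d by rewrite /p /em_prim flE; ring.
have [J1c J1v] := line_integral_complex (fun u => J1_line indep pole k1 u e0).
have {}J1v : J1 w1 w2 k a y0 eps = of_parts (fun u => p u c - p u d).
  by rewrite /J1 J1v /of_parts -!J1E.
have strip := strip_J23 indep pole k1 y0i.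
have s2 M : c <= M -> M < y0 \/ y0 < c by right.
have s3 M : - M <= d -> d < y0 \/ y0 < - M by left.
have S2 : J2_strips_converge w1 w2 k a y0 eps.
  by move=> M; exact: (strip _ _ (s2 M)).1.
have S3 : J3_strips_converge w1 w2 k a y0 eps.
  by move=> M; exact: (strip _ _ (s3 M)).1.
have V2 : \forall M \near +oo,
    J2_upto w1 w2 k a y0 eps M = of_parts (fun u => p u M - p u c).
  near=> M; apply: (strip _ _ (s2 M)).2.
  by near: M; apply: nbhs_pinfty_ge; rewrite num_real.
have V3 : \forall M \near +oo,
    J3_upto w1 w2 k a y0 eps M = of_parts (fun u => p u d - p u (- M)).
  near=> M; apply: (strip _ _ (s3 M)).2.
  by rewrite lerNl; near: M; apply: nbhs_pinfty_ge; rewrite num_real.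
split=> // [k1E|k2].
  have cv : (fun M => J2_upto w1 w2 k a y0 eps M + J3_upto w1 w2 k a y0 eps M)
      @ +oo --> (of_parts (fun u => tot u - (p u c - p u d)) : R[i]^o).
    apply: (@cvg_of_parts _ _ _ (fun u M => (p u M - p u (- M)) - (p u c - p u d))).
      move: V2 V3; apply: filterS2 => M -> ->; rewrite of_partsD.
      by congr of_parts; apply/funext => u; exact: outer_parts.
    move=> u; apply: cvgB; last exact: cvg_cst.
    exact: (cvg_prim_sym indep pole).
  split; first by split; [exact: S2|exact: S3|apply/cvg_ex; eexists; exact: cv].
  rewrite J1v /J23_pv (lim_complex cv) of_partsD.
  by congr of_parts; apply/funext => u; rewrite subrKC.
have top_cv u : p u M @[M --> +oo] --> tp u by exact: (cvg_prim_top indep pole).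
have bot_cv u : p u (- M) @[M --> +oo] --> tp u - tot u.
  exact: (cvg_prim_bot indep pole).
have em := Rintegral_row_integral indep pole k1 y0i.
have seq_oo (r : R) : r + n%:R @[n --> \oo] --> +oo.
  apply/cvgryPge => B; near=> n.
  by rewrite -lerBlDl; near: n; exact: nbhs_infty_ger.
have [J2c J2v] : J2_converges w1 w2 k a y0 eps /\
    J2 w1 w2 k a y0 eps = of_parts (fun u => tp u - p u c).
  have cv : J2_upto w1 w2 k a y0 eps @ +oo -->
      (of_parts (fun u => tp u - p u c) : R[i]^o).
    apply: cvg_of_parts V2 _ => u.
    by apply: cvgB; [exact: top_cv|exact: cvg_cst].
  rewrite /J2_converges /J2; case: ltnP => k3; last first.
    by split; [split; [exact: S2|apply/cvg_ex; eexists; exact: cv]|exact: lim_complex].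
  apply: (@half_plane_J23 _ _ _ _ _ _ _ indep pole k1 _ eps
    (fun n => `[c, c + n%:R]%classic)) => //.
  - move=> y; rewrite /= in_itv /= andbT /c => cy.
    by apply: le_trans (ler_norm _); lra.
  - by move=> n y; rewrite /= !in_itv /= andbT => /andP[].
  - move=> y; rewrite /= in_itv /= andbT => cy; near=> n.
    rewrite /= in_itv /= cy -lerBlDl; near: n; exact: nbhs_infty_ger.
  move=> u; rewrite (_ : (fun n => _) = fun n : nat => p u (c + n%:R) - p u c).
    apply: cvgB; last exact: cvg_cst.
    exact: (proj1 (cvg_pinftyP _ _) (top_cv u) _ (seq_oo c)).
  by apply/funext => n; apply: em; [rewrite lerDl|right].
have [J3c J3v] : J3_converges w1 w2 k a y0 eps /\
    J3 w1 w2 k a y0 eps = of_parts (fun u => p u d - (tp u - tot u)).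
  have cv : J3_upto w1 w2 k a y0 eps @ +oo -->
      (of_parts (fun u => p u d - (tp u - tot u)) : R[i]^o).
    apply: cvg_of_parts V3 _ => u.
    by apply: cvgB; [exact: cvg_cst|exact: bot_cv].
  rewrite /J3_converges /J3; case: ltnP => k3; last first.
    by split; [split; [exact: S3|apply/cvg_ex; eexists; exact: cv]|exact: lim_complex].
  apply: (@half_plane_J23 _ _ _ _ _ _ _ indep pole k1 _ eps
    (fun n => `[- (- d + n%:R), d]%classic)) => //.
  - move=> y; rewrite /= in_itv /= /d => cy.
    by rewrite distrC; apply: le_trans (ler_norm _); lra.
  - by move=> n y; rewrite /= !in_itv /= => /andP[].
  - move=> y; rewrite /= in_itv /= => yd; near=> n.
    rewrite /= in_itv /= yd andbT lerNl -lerBlDl; near: n; exact: nbhs_infty_ger.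
  move=> u; rewrite (_ : (fun n => _) = fun n : nat => p u d - p u (- (- d + n%:R))).
    apply: cvgB; first exact: cvg_cst.
    exact: (proj1 (cvg_pinftyP _ _) (bot_cv u) _ (seq_oo (- d))).
  by apply/funext => n; apply: em; [rewrite lerNl lerDl|left].
split; [exact: J2c|exact: J3c|rewrite J1v J2v J3v !of_partsD;
by congr of_parts; apply/funext => u; rewrite all_parts].
Unshelve. all: by end_near. Qed.
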